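(* Let $R=R(A_1,S)$ be an extended affine root system of type $A_1$, with $\psi:\hat{\mathcal W}\to\mathcal W$, $\hat Z$ and $\hat u(\tilde m,\tilde\epsilon)$ as defined in the context. (i) $\ker(\psi)\subseteq\hat Z$. (ii) If $\hat u\in\hat Z$, then the following statements are equivalent: (a) $\hat u\in\ker(\psi)$; (b) $\hat u^2=1$; (c) $\hat u$ has finite order; (d) $\hat u=\hat u(\tilde m,\tilde\epsilon)$, where $\tilde\epsilon=\{\epsilon_J\}_{J\in\mathrm{Esupp}(S)}$ is an integral collection for $S$ satisfying $$m_{r,s}=-\frac{1}{\delta(r,s)}\sum_{J\in\mathrm{Esupp}(S)}\delta(J,r,s)\,\epsilon_J\qquad(1\le r<s\le\nu).\qquad( * )$$ (iii) The assignment $\tilde\epsilon=\{\epsilon_J\}\longmapsto\hat u(\tilde m,\tilde\epsilon)$, where $\tilde m=\{m_{r,s}\}$ satisfies $( * )$, is a one to one correspondence from the set of integral collections for $S$ onto $\ker(\psi)$.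
   Context: Semilattices. Let $\mathcal V^0$ be a finite dimensional real vector space of dimension $\nu$. A semilattice in $\mathcal V^0$ is a subset $S\subseteq\mathcal V^0$ such that $0\in S$, $S\pm 2S\subseteq S$, $S$ spans $\mathcal V^0$ and $S$ is discrete in $\mathcal V^0$. The $\mathbb Z$-span $\Lambda$ of $S$ is a lattice in $\mathcal V^0$ having a $\mathbb Z$-basis contained in $S$; fix such a basis $\{\sigma_1,\ldots,\sigma_\nu\}\subseteq S$. For $J\subseteq J_\nu:=\{1,\ldots,\nu\}$ put $\tau_J:=\sum_{j\in J}\sigma_j$ ($\tau_\emptyset=0$). $\mathrm{supp}(S)$ is the unique collection of subsets of $J_\nu$ with $\emptyset\in\mathrm{supp}(S)$ and $S=\bigcup_{J\in\mathrm{supp}(S)}(\tau_J+2\Lambda)$. Put $\mathrm{Esupp}(S)=\{J\in\mathrm{supp}(S): |J|\ge 3\}$. Integral collections. For $1\le r<s\le\nu$ let $\delta(r,s)=1$ if $\{r,s\}\in\mathrm{supp}(S)$ and $\delta(r,s)=2$ otherwise; for $J\in\mathrm{supp}(S)$ let $\delta(J,r,s)=1$ if $\{r,s\}\subsetneq J$ and $\delta(J,r,s)=0$ otherwise. A collection $\{\epsilon_J\}_{J\in\mathrm{Esupp}(S)}$ with $\epsilon_J\in\{0,1\}$ is an integral collection for $S$ if $\frac{1}{\delta(r,s)}\sum_{J\in\mathrm{Esupp}(S)}\delta(J,r,s)\epsilon_J\in\mathbb Z$ for all $1\le r<s\le\nu$ (if $\mathrm{Esupp}(S)=\emptyset$,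 the only collection is the zero collection, and it is integral). Root system and Weyl group. Let $\mathcal V=\mathbb R\alpha_1\oplus\mathcal V^0$ with the positive semi-definite symmetric bilinear form having radical $\mathcal V^0$ and $(\alpha_1,\alpha_1)=2$. The extended affine root system $R=R(A_1,S)$ is $R=(S+S)\cup(\pm\alpha_1+S)$, with $S$ a semilattice in $\mathcal V^0$, and $R^\times=\pm\alpha_1+S$ is its set of non-isotropic elements. Let $\tilde{\mathcal V}=\mathcal V\oplus(\mathcal V^0)^*$ with the non-degenerate symmetric form extending that of $\mathcal V$ such that $(\alpha_1,(\mathcal V^0)^* )=((\mathcal V^0)^*,(\mathcal V^0)^* )=0$ and $(\sigma_i,\lambda_j)=\delta_{i,j}$ for a basis $\{\lambda_1,\ldots,\lambda_\nu\}$ of $(\mathcal V^0)^*$. The extended affine Weyl group $\mathcal W$ is the subgroup of the orthogonal group of $\tilde{\mathcal V}$ generated by the reflections $w_\alpha(u)=u-(u,\alpha)\alpha$, $\alpha\in R^\times$. Presented group. $\hat{\mathcal W}$ is the group with generators $\hat w_\alpha$, $\alpha\in R^\times$, and relations $\hat w_\alpha^2=1$ and $\hat w_\alpha\hat w_\beta\hat w_\alpha=\hat w_{w_\alpha(\beta)}$ ($\alpha,\beta\in R^\times$); $\psi:\hat{\mathcal W}\to\mathcal W$ is the epimorphism induced by $\hat w_\alpha\mapsto w_\alpha$. For $r\in J_\nu$ put $\hat t_{1,r}=\hat w_{\alpha_1+\sigma_r}\hat w_{\alpha_1}$. With $[x,y]=x^{-1}y^{-1}xy$ and products over $J$ taken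 in increasing order of indices, put, for $J\subseteq J_\nu$: $\hat z_J=\hat w_{\alpha_1}\hat w_{\alpha_1+\tau_J}\prod_{r\in J}\hat t_{1,r}$ if $J\in\mathrm{supp}(S)$; $\hat z_J=[\hat t_{1,r},\hat t_{1,s}]$ if $J=\{r,s\}\notin\mathrm{supp}(S)$, $r<s$; $\hat z_J=1$ otherwise. All $\hat z_J$ are central in $\hat{\mathcal W}$; put $\hat Z=\langle\hat z_J\mid J\subseteq J_\nu\rangle$. For a pair $(\tilde m,\tilde\epsilon)=(\{m_{r,s}\}_{1\le r<s\le\nu},\{\epsilon_J\}_{J\in\mathrm{Esupp}(S)})$ with $m_{r,s}\in\mathbb Z$, $\epsilon_J\in\{0,1\}$, put $\hat u(\tilde m,\tilde\epsilon)=\prod_{1\le r<s\le\nu}\hat z_{\{r,s\}}^{m_{r,s}}\prod_{J\in\mathrm{Esupp}(S)}\hat z_J^{\epsilon_J}$. *)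

(* Defs.v *)
From HB Require Import structures.
From mathcomp Require Import all_boot all_order all_algebra.
From mathcomp Require Import all_classical all_reals topology normedtype.
From mathcomp Require Import ring.

Set Implicit Arguments.
Unset Strict Implicit.
Unset Printing Implicit Defensive.

Import Order.TTheory GRing.Theory Num.Theory.
Import numFieldNormedType.Exports.

Local Open Scope classical_set_scope.
Local Open Scope quotient_scope.
Local Open Scope ring_scope.

Definition expgz (G : groupType) (x : G) (k : int) : G :=
  (match k with Posz n => x ^+ n | Negz n => x ^- n.+1 end)%g.

Definition subgroup_gen (G : groupType) (A : set G) : set G :=
  smallest (fun H : set G => group_closed [in H]) A.

Lemma subgroup_gen_closed (G : groupType) (A : set G) :
  group_closed [in subgroup_gen A].
Proof.
have E (x : G) : (x \in [in subgroup_gen A]) = (x \in subgroup_gen A) by [].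
split=> [|x y]; rewrite ?E.
  by apply/mem_set => H [[H1 _] _]; apply/set_mem.
move=> /set_mem xA /set_mem yA; apply/mem_set => H HA.
have [[_ HF] _] := HA; apply/set_mem.
by apply: HF; apply/mem_set; [apply: xA|apply: yA].
Qed.

(** [(x, true)] is the letter x and [(x, false)] is its formal inverse. *)
Definition word (X : Type) := seq (X * bool).

Definition letter_inv (X : Type) (l : X * bool) : X * bool := (l.1, ~~ l.2).
Definition word_inv (X : Type) (w : word X) : word X :=
  rev (map (@letter_inv X) w).

Section Presentation.
Variables (X : choiceType) (rels : word X -> word X -> Prop).

(** The least congruence on words that identifies the two sides of every
    relation and cancels adjacent inverse letters. *)
Inductive word_eq : word X -> word X -> Prop :=
| word_eq_refl w : word_eq w w
| word_eq_sym v w : word_eq v w -> word_eq w v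
| word_eq_trans u v w : word_eq u v -> word_eq v w -> word_eq u w
| word_eq_cat v v' w w' :
    word_eq v v' -> word_eq w w' -> word_eq (v ++ w) (v' ++ w')
| word_eq_cancel l : word_eq [:: l; letter_inv l] [::]
| word_eq_rel v w : rels v w -> word_eq v w.

Definition word_eqb (v w : word X) : bool := `[< word_eq v w >].

Lemma word_eqb_refl : reflexive word_eqb.
Proof. by move=> w; apply/asboolP; apply: word_eq_refl. Qed.

Lemma word_eqb_sym : symmetric word_eqb.
Proof. by move=> v w; apply/asboolP/asboolP; apply: word_eq_sym. Qed.

Lemma word_eqb_trans : transitive word_eqb.
Proof.
by move=> v u w /asboolP uv /asboolP vw; apply/asboolP; apply: word_eq_trans vw.
Qed.

Canonical word_equiv := EquivRel word_eqb word_eqb_refl word_eqb_sym word_eqb_trans.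

Definition presented : Type := {eq_quot word_equiv}.
HB.instance Definition _ := Choice.copy presented {eq_quot word_equiv}.

Definition pres_class (w : word X) : presented := \pi_{eq_quot word_equiv} w.
Definition pres_word (x : presented) : word X :=
  repr (x : {eq_quot word_equiv}).

Lemma pres_classP v w : pres_class v = pres_class w <-> word_eq v w.
Proof.
split=> [/eqP|vw]; first by rewrite eqmodE => /asboolP.
by apply/eqP; rewrite eqmodE; apply/asboolP.
Qed.

Lemma pres_wordK : cancel pres_word pres_class.
Proof. by move=> x; apply: reprK. Qed.

Lemma pres_classK w : word_eq (pres_word (pres_class w)) w.
Proof. by apply/pres_classP; rewrite pres_wordK. Qed.

Lemma letter_invK : involutive (@letter_inv X).
Proof. by case=> x b; rewrite /letter_inv /= negbK. Qed.

Lemma word_invK : involutive (@word_inv X).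
Proof.
move=> w; rewrite /word_inv map_rev revK -map_comp map_id_in // => l _ /=.
exact: letter_invK.
Qed.

Lemma word_eq_mulwV w : word_eq (w ++ word_inv w) [::].
Proof.
elim: w => [|l w IHw]; first exact: word_eq_refl.
have -> : (l :: w) ++ word_inv (l :: w) =
          [:: l] ++ ((w ++ word_inv w) ++ [:: letter_inv l]).
  by rewrite /word_inv /= rev_cons -cats1 -!catA.
apply: word_eq_trans (word_eq_cancel l).
have R := word_eq_refl.
exact: (word_eq_cat (R [:: l]) (word_eq_cat IHw (R [:: letter_inv l]))).
Qed.

Lemma word_eq_mulVw w : word_eq (word_inv w ++ w) [::].
Proof. by have := word_eq_mulwV (word_inv w); rewrite word_invK. Qed.

Lemma word_eq_inv v w : word_eq v w -> word_eq (word_inv v) (word_inv w).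
Proof.
move=> vw; have R := word_eq_refl.
apply: (@word_eq_trans _ (word_inv v ++ (w ++ word_inv w))).
  rewrite -[X in word_eq X _]cats0; apply: word_eq_cat => //.
  exact/word_eq_sym/word_eq_mulwV.
rewrite catA -[X in word_eq _ X]cat0s; apply: word_eq_cat => //.
apply: word_eq_trans (word_eq_mulVw v).
by apply: word_eq_cat => //; apply: word_eq_sym.
Qed.

Definition pres_mul (x y : presented) := pres_class (pres_word x ++ pres_word y).
Definition pres_one := pres_class [::].
Definition pres_inv (x : presented) := pres_class (word_inv (pres_word x)).

Lemma pres_mulE v w :
  pres_mul (pres_class v) (pres_class w) = pres_class (v ++ w).
Proof. by apply/pres_classP/word_eq_cat; apply: pres_classK. Qed.

Lemma pres_invE w : pres_inv (pres_class w) = pres_class (word_inv w).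
Proof. by apply/pres_classP/word_eq_inv; apply: pres_classK. Qed.

Lemma pres_mulA : associative pres_mul.
Proof.
move=> x y z; rewrite -(pres_wordK x) -(pres_wordK y) -(pres_wordK z).
by rewrite !pres_mulE catA.
Qed.

Lemma pres_mul1 : left_id pres_one pres_mul.
Proof. by move=> x; rewrite -(pres_wordK x) pres_mulE. Qed.

Lemma pres_mulr1 : right_id pres_one pres_mul.
Proof. by move=> x; rewrite -(pres_wordK x) pres_mulE cats0. Qed.

Lemma pres_mulV : left_inverse pres_one pres_inv pres_mul.
Proof.
move=> x; rewrite -(pres_wordK x) pres_invE pres_mulE.
exact/pres_classP/word_eq_mulVw.
Qed.

Lemma pres_mulrV : right_inverse pres_one pres_inv pres_mul.
Proof.
move=> x; rewrite -(pres_wordK x) pres_invE pres_mulE.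
exact/pres_classP/word_eq_mulwV.
Qed.

HB.instance Definition _ :=
  isGroup.Build presented pres_mulA pres_mul1 pres_mulr1 pres_mulV pres_mulrV.

Lemma pres_classM v w :
  (pres_class v * pres_class w)%g = pres_class (v ++ w).
Proof. exact: pres_mulE. Qed.

Definition pres_gen (x : X) : presented := pres_class [:: (x, true)].

Section Lift.
Variables (G : groupType) (f : X -> G).

Definition word_eval (w : word X) : G :=
  (\prod_(l <- w) (if l.2 then f l.1 else (f l.1)^-1))%g.

Lemma word_eval_cat v w : word_eval (v ++ w) = (word_eval v * word_eval w)%g.
Proof. exact: big_cat. Qed.

Definition pres_lift (x : presented) : G := word_eval (pres_word x).

Hypothesis f_rels : forall v w, rels v w -> word_eval v = word_eval w.

Lemma word_evalP v w : word_eq v w -> word_eval v = word_eval w.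
Proof.
elim=> {v w} //.
- by move=> u v w _ -> _ ->.
- by move=> v v' w w' _ Hv _ Hw; rewrite !word_eval_cat Hv Hw.
case=> x b; rewrite /word_eval !big_cons !big_nil mulg1 /=.
by case: b; rewrite /= ?mulgV ?mulVg.
Qed.

Lemma pres_liftE w : pres_lift (pres_class w) = word_eval w.
Proof. exact/word_evalP/pres_classK. Qed.

Lemma pres_liftM x y : pres_lift (x * y)%g = (pres_lift x * pres_lift y)%g.
Proof.
rewrite -(pres_wordK x) -(pres_wordK y).
by rewrite pres_classM !pres_liftE word_eval_cat.
Qed.

Lemma pres_lift_gen x : pres_lift (pres_gen x) = f x.
Proof. by rewrite pres_liftE /word_eval big_cons big_nil mulg1. Qed.

End Lift.
End Presentation.

Section Semilattice.
Variables (R : realType) (V0 : vectType R).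
Implicit Types (S : set V0).

(** A finite dimensional real vector space carries a unique Hausdorff vector
    space topology: the one transported from [R^n] through any basis. *)
Definition coords (x : V0) : 'rV[R]_(\dim {:V0}) :=
  \row_i coord (vbasis {:V0}) i x.

Definition discrete_subset S := coords @` S `<=` isolated (coords @` S).

Definition spanning S :=
  exists2 X : seq V0, (forall x, x \in X -> S x) & <<X>>%VS = {:V0}%VS.

Definition semilattice S :=
  [/\ S 0,
      forall x y, S x -> S y -> S (x + y *+ 2) /\ S (x - y *+ 2),
      spanning S
    & discrete_subset S].

Definition Zcomb n (sigma : 'I_n -> V0) (c : {ffun 'I_n -> int}) : V0 :=
  \sum_i sigma i *~ c i.

Definition Zspan S : set V0 :=
  [set x | exists n (a : 'I_n -> V0) (c : {ffun 'I_n -> int}),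
     (forall i, S (a i)) /\ x = Zcomb a c].

Definition Zbasis n (L : set V0) (sigma : 'I_n -> V0) :=
  (forall i, L (sigma i)) /\ (forall x, L x -> exists! c, x = Zcomb sigma c).

Section Support.
Variables (nu : nat) (S : set V0) (sigma : 'I_nu -> V0).

Definition tau (J : {set 'I_nu}) : V0 := \sum_(j in J) sigma j.

(** For a semilattice S with Z-basis sigma of its Z-span contained in S, there is
    exactly one such collection. *)
Definition is_supp (supp : {set {set 'I_nu}}) :=
  finset.set0 \in supp /\
  S = \bigcup_(J in [set` supp]) [set tau J + x *+ 2 | x in Zspan S].

End Support.
End Semilattice.

Section Integral.
Variables (nu : nat) (supp : {set {set 'I_nu}}).

Definition Esupp : {set {set 'I_nu}} := [set J in supp | (2 < #|J|)%N].

Definition delta (r s : 'I_nu) : nat := if [set r; s]%SET \in supp then 1 else 2.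

Definition deltaJ (J : {set 'I_nu}) (r s : 'I_nu) : nat := [set r; s]%SET \proper J.

(** Families (epsilon_J), J in Esupp, with values in {0, 1}. *)
Definition collection := {ffun {J : {set 'I_nu} | J \in Esupp} -> bool}.

Definition eps_avg (eps : collection) (r s : 'I_nu) : rat :=
  (delta r s)%:R^-1 * \sum_J (deltaJ (val J) r s * eps J)%:R.

Definition integral_collection (eps : collection) :=
  forall r s : 'I_nu, (r < s)%N -> eps_avg eps r s \is a Num.int.

(** Exponents m_{r,s} are only relevant for r < s. *)
Definition exps_of (m : 'I_nu -> 'I_nu -> int) (eps : collection) :=
  forall r s : 'I_nu, (r < s)%N -> (m r s)%:~R = - eps_avg eps r s.

(** The exponents determined by an integral collection, see [exps_ofP]; the
    rounding only matters for collections that are not integral. *)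
Definition exps (eps : collection) (r s : 'I_nu) : int :=
  Num.floor (- eps_avg eps r s).

Lemma exps_ofP eps : integral_collection eps -> exps_of (exps eps) eps.
Proof. by move=> Ieps r s rs; apply/eqP; rewrite -intrEfloor rpredN Ieps. Qed.

End Integral.

Section Roots.
Variables (R : realType) (V0 : vectType R).

(** (R alpha_1 + V^0) + (V^0)^*, the dual being the space of linear forms. *)
Definition Vt : vectType R := (R^o * V0 * 'Hom(V0, R^o))%type.

Definition form (u v : Vt) : R :=
  2 * (u.1.1 : R) * v.1.1 + (u.2 v.1.2 + v.2 u.1.2).

Definition alpha1 : Vt := ((1, 0), 0).
Definition iso (x : V0) : Vt := ((0, x), 0).

Lemma formC u v : form u v = form v u.
Proof. by rewrite /form; ring. Qed.

Lemma formDZ a u v w : form (a *: u + v) w = a * form u w + form v w.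
Proof.
have E (p q r : R) : p *: (q : R^o) + r = p * q + r by [].
by rewrite /form /= linearP /= add_lfunE scale_lfunE !E; ring.
Qed.

Lemma formDZr a u v w : form w (a *: u + v) = a * form w u + form w v.
Proof. by rewrite formC formDZ !(formC w). Qed.

Lemma form0l v : form 0 v = 0.
Proof.
have /esym/eqP := formDZ 1 0 0 v.
by rewrite scale1r addr0 mul1r -subr_eq0 addrK => /eqP.
Qed.

Lemma form_nondegenerate u : (forall v, form u v = 0) -> u = 0.
Proof.
case: u => [[a x] f] H.
have a0 : a = 0.
  have := H alpha1; rewrite /form /= linear0 lfunE /= !addr0 mulr1.
  by move/eqP; rewrite mulf_eq0 pnatr_eq0 /= => /eqP.
have x0 : x = 0.
  rewrite (coord_vbasis (memvf x)) big1 // => i _.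
  have := H (((0, 0), linfun (coord (vbasis {:V0}) i : V0 -> R^o)) : Vt).
  by rewrite /form /= linear0 mulr0 !add0r lfunE /= => ->; rewrite scale0r.
have f0 : f = 0.
  apply/lfunP => y; have := H (iso y).
  by rewrite /form /= mulr0 !lfunE /= add0r addr0.
by rewrite a0 x0 f0.
Qed.

(** The group of isometries of [Vt]; they are invertible because the form is
    non-degenerate. *)
Definition orthogonal (f : 'End(Vt)) :=
  forall u v, form (f u) (f v) = form u v.

Definition orth := {f : 'End(Vt) | `[< orthogonal f >]}.
HB.instance Definition _ := Choice.on orth.

Definition orth_fun (g : orth) : Vt -> Vt := val g.

Lemma orthP (g : orth) : orthogonal (val g).
Proof. by case: g => f /= /asboolP. Qed.

Lemma orth_eqP (g h : orth) : (forall u, orth_fun g u = orth_fun h u) -> g = h.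
Proof. by move=> gh; apply/val_inj/lfunP. Qed.

Lemma orthogonal_ker f : orthogonal f -> lker f == 0%VS.
Proof.
move=> fO; apply/lker0P => u v fuv; apply/eqP; rewrite -subr_eq0; apply/eqP.
apply: form_nondegenerate => w; rewrite -fO linearB /= fuv subrr.
exact: form0l.
Qed.

Lemma orth_one_subproof : `[< orthogonal \1%VF >].
Proof. by apply/asboolP => u v; rewrite !id_lfunE. Qed.

Lemma orth_mul_subproof (g h : orth) : `[< orthogonal (val g \o val h)%VF >].
Proof. by apply/asboolP => u v; rewrite !comp_lfunE !orthP. Qed.

Lemma orth_inv_subproof (g : orth) : `[< orthogonal (val g)^-1%VF >].
Proof.
apply/asboolP => u v; rewrite -(orthP g).
by rewrite !(lker0_lfunVK (orthogonal_ker (orthP g))).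
Qed.

Definition orth_of (f : 'End(Vt)) (fO : `[< orthogonal f >]) : orth := exist _ f fO.
Definition orth_one : orth := orth_of orth_one_subproof.
Definition orth_mul (g h : orth) : orth := orth_of (orth_mul_subproof g h).
Definition orth_inv (g : orth) : orth := orth_of (orth_inv_subproof g).

Lemma orth_mulA : associative orth_mul.
Proof. by move=> g h k; apply: val_inj; rewrite /= comp_lfunA. Qed.

Lemma orth_mul1 : left_id orth_one orth_mul.
Proof. by move=> g; apply: val_inj; rewrite /= comp_lfun1l. Qed.

Lemma orth_mulr1 : right_id orth_one orth_mul.
Proof. by move=> g; apply: val_inj; rewrite /= comp_lfun1r. Qed.

Lemma orth_mulV : left_inverse orth_one orth_inv orth_mul.
Proof.
move=> g; apply: orth_eqP => u; rewrite /orth_fun /= comp_lfunE id_lfunE.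
exact: (lker0_lfunK (orthogonal_ker (orthP g))).
Qed.

Lemma orth_mulrV : right_inverse orth_one orth_inv orth_mul.
Proof.
move=> g; apply: orth_eqP => u; rewrite /orth_fun /= comp_lfunE id_lfunE.
exact: (lker0_lfunVK (orthogonal_ker (orthP g))).
Qed.

HB.instance Definition _ :=
  isGroup.Build orth orth_mulA orth_mul1 orth_mulr1 orth_mulV orth_mulrV.

Lemma orth_mulE (g h : orth) u : orth_fun (g * h)%g u = orth_fun g (orth_fun h u).
Proof. by rewrite /orth_fun /= comp_lfunE. Qed.

Lemma orth_oneE u : orth_fun 1%g u = u.
Proof. by rewrite /orth_fun /= id_lfunE. Qed.

Definition reflection (a u : Vt) : Vt := u - form u a *: a.

Lemma reflection_linear a : linear (reflection a).
Proof.
move=> k u v; rewrite /reflection formDZ scalerDl scalerBr scalerA opprD.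
by rewrite addrACA.
Qed.

HB.instance Definition _ a :=
  GRing.isLinear.Build R Vt Vt *:%R (reflection a) (reflection_linear a).

Lemma form_reflection a u v : form a a = 2 ->
  form (reflection a u) (reflection a v) = form u v.
Proof.
have E w : reflection a w = - form w a *: a + w by rewrite /reflection addrC scaleNr.
by move=> a2; rewrite !E !formDZ !formDZr a2 !(formC a); ring.
Qed.

Section RootSystem.
Variable S : set V0.

Definition eroots : set Vt :=
  [set iso (x + y) | x in S & y in S] `|`
  ([set alpha1 + iso x | x in S] `|` [set - alpha1 + iso x | x in S]).

(** R^x, the set of non-isotropic roots. *)
Definition Rx : set Vt := [set a | eroots a /\ form a a != 0].

Lemma form_alpha1_iso x : form (alpha1 + iso x) (alpha1 + iso x) = 2.
Proof. by rewrite /form /= !add0r !lfunE /= addr0; ring. Qed.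

Lemma form_Nalpha1_iso x : form (- alpha1 + iso x) (- alpha1 + iso x) = 2.
Proof. by rewrite /form /= oppr0 !add0r !lfunE /= addr0; ring. Qed.

Lemma form_iso x : form (iso x) (iso x) = 0.
Proof. by rewrite /form /= !lfunE /=; ring. Qed.

Lemma RxE :
  Rx = [set alpha1 + iso x | x in S] `|` [set - alpha1 + iso x | x in S].
Proof.
apply/seteqP; split=> a.
  by case=> -[[x _ [y _ <-]]|//]; rewrite form_iso eqxx.
move=> aR; split; first by right.
by case: aR => -[x _ <-]; rewrite ?form_alpha1_iso ?form_Nalpha1_iso pnatr_eq0.
Qed.

Lemma Rx_norm (a : Rx) : form (val a) (val a) = 2.
Proof.
have := set_valP a; rewrite {1}RxE.
by case=> -[x _ <-]; rewrite ?form_alpha1_iso ?form_Nalpha1_iso.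
Qed.

Lemma refl_subproof (a : Rx) : `[< orthogonal (linfun (reflection (val a))) >].
Proof.
by apply/asboolP => u v; rewrite !lfunE /= form_reflection // Rx_norm.
Qed.

Definition refl (a : Rx) : orth := orth_of (refl_subproof a).

Lemma reflE a u : orth_fun (refl a) u = reflection (val a) u.
Proof. by rewrite /orth_fun /= lfunE. Qed.

Definition weyl_set : set orth := subgroup_gen (range refl).

Definition weyl := {g : orth | g \in weyl_set}.
HB.instance Definition _ := SubType.on weyl.
HB.instance Definition _ := Choice.on weyl.
HB.instance Definition _ := SubChoice_isSubGroup.Build orth [in weyl_set] weyl
  (subgroup_gen_closed (range refl)).

Lemma weyl_refl_subproof a : refl a \in weyl_set.
Proof. by apply/mem_set => H [_]; apply; exists a. Qed.

Definition weyl_refl (a : Rx) : weyl :=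
  exist _ (refl a) (weyl_refl_subproof a).

(** When S is a semilattice, w_a(b) is always a root, so that the second family
    of relations is indexed by all pairs (a, b). *)
Inductive what_rel : word Rx -> word Rx -> Prop :=
| what_rel_sq a : what_rel [:: (a, true); (a, true)] [::]
| what_rel_conj a b c : val c = reflection (val a) (val b) ->
    what_rel [:: (a, true); (b, true); (a, true)] [:: (c, true)].

Definition what := presented what_rel.
HB.instance Definition _ := Group.on what.

Definition psi : what -> weyl := pres_lift weyl_refl.

Lemma psi_rels v w : what_rel v w ->
  word_eval weyl_refl v = word_eval weyl_refl w.
Proof.
have sq (a : Rx) u : reflection (val a) (reflection (val a) u) = u.
  rewrite {1}/reflection.
  have -> : form (reflection (val a) u) (val a) = - form u (val a).
    rewrite /reflection addrC -scaleNr formDZ Rx_norm; ring.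
  by rewrite scaleNr opprK /reflection subrK.
case=> [a|a b c cE]; rewrite /word_eval !big_cons !big_nil /= !mulg1;
  apply: val_inj; apply: orth_eqP => u.
  by rewrite [val _]/= orth_mulE !reflE sq orth_oneE.
rewrite ![val _]/= !orth_mulE !reflE cE.
rewrite [reflection (val b) _]/reflection linearB linearZ /= sq.
by rewrite -(form_reflection _ (val b) (Rx_norm a)) sq.
Qed.

Lemma psiM (x y : what) : psi (x * y)%g = (psi x * psi y)%g.
Proof. exact: pres_liftM psi_rels x y. Qed.

Lemma psi1 : psi 1%g = 1%g.
Proof. by apply: (@mulgI _ (psi 1)%g); rewrite -psiM !mulg1. Qed.

HB.instance Definition _ := isUMagmaMorphism.Build what weyl psi (psi1, psiM).

Lemma psi_gen a : psi (pres_gen what_rel a) = weyl_refl a.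
Proof. exact: pres_lift_gen psi_rels a. Qed.

Lemma psi_surj : set_surj setT setT psi.
Proof.
move=> w _; have := valP w => /set_mem /(_ [set val (psi u) | u in setT]).
case=> [|u _ /val_inj uw]; last by exists u.
split=> [|_ [a _ <-]]; last by exists (pres_gen what_rel a); rewrite ?psi_gen.
split=> [|_ _ /set_mem[u _ <-] /set_mem[v _ <-]]; apply/mem_set.
  by exists 1%g; rewrite // psi1.
by exists (u / v)%g => //; rewrite gmulfF.
Qed.

Definition ker_psi : set what := [set u | psi u = 1%g].

(** The generator attached to a root a; the value at vectors a outside [Rx] is
    irrelevant. *)
Definition what_gen (a : Vt) : what :=
  if insub a is Some x then pres_gen what_rel x else 1%g.

Section CentralElements.
Variables (nu : nat) (sigma : 'I_nu -> V0) (supp : {set {set 'I_nu}}).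

Definition hat_t (r : 'I_nu) : what :=
  (what_gen (alpha1 + iso (sigma r)) * what_gen alpha1)%g.

(** Ordinal-indexed products run in increasing order. In the second case the
    pair (r, s) with r < s and J = {r, s} is unique. *)
Definition hat_z (J : {set 'I_nu}) : what :=
  if J \in supp then
    (what_gen alpha1 * what_gen (alpha1 + iso (tau sigma J)) *
     \prod_(r < nu | r \in J) hat_t r)%g
  else if [pick p : 'I_nu * 'I_nu | (p.1 < p.2)%N && (J == [set p.1; p.2]%SET)]
    is Some p then [~ hat_t p.1, hat_t p.2]%g
  else 1%g.

Definition hat_Z : set what := subgroup_gen (range hat_z).

(** The elements [hat_z J] are central when S is a semilattice, so the order of
    the factors is immaterial. *)
Definition hat_u (m : 'I_nu -> 'I_nu -> int) (eps : collection supp) : what :=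
  ((\prod_(p : 'I_nu * 'I_nu | (p.1 < p.2)%N)
      expgz (hat_z [set p.1; p.2]%SET) (m p.1 p.2)) *
   \prod_(J : {J : {set 'I_nu} | J \in Esupp supp}) hat_z (val J) ^+ eps J)%g.

End CentralElements.
End RootSystem.
End Roots.

Arguments ker_psi {R V0} S _.
Arguments hat_z {R V0} S {nu} sigma supp J.
Arguments hat_Z {R V0} S {nu} sigma supp _.
Arguments hat_u {R V0} S {nu} sigma {supp} m eps.

(* Main.v *)
(** Write [w_x] for the generator attached to [alpha_1 + x].  The relations say
    [w_x w_y w_x = w_(2x-y)], so conjugation by [t_x = w_x w_0] carries [w_y] to
    [w_(y+2x)].  Each [z_J] and each commutator [[t_r, t_s]] conjugates every
    generator by a zero translation, hence is central.  Modulo the group P spanned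
    by the [z_{r,s}] the [t_r] commute, which gives [z_J^2] in P and the normal form
    [u(m, epsilon)] of the elements of Z.

    In the Weyl group the [t]-words act as a Heisenberg group, in which [z_J] has
    central part the sum over [r < s] in J of [sigma_r /\ sigma_s] (twice this if
    J = {r, s} is not in supp(S)).  These bivectors are independent, so psi is
    injective on P, and u(m, epsilon) is in ker(psi), or is torsion, exactly when
    all coefficients vanish, which is condition [( * )].  Finally epsilon is
    recovered from u(m, epsilon) through the homomorphisms to Z/2 sending [w_x] to 1
    iff x lies in a given coset [tau_J + 2 Lambda]. *)

From HB Require Import structures.
Require Import Defs.
From mathcomp Require Import all_boot all_order all_algebra fingroup perm.
From mathcomp Require Import all_classical all_reals topology normedtype.
From mathcomp Require Import ring zify.

Set Implicit Arguments.
Unset Strict Implicit.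
Unset Printing Implicit Defensive.

Import Order.TTheory GRing.Theory Num.Theory.

Local Open Scope classical_set_scope.
Local Open Scope ring_scope.

(** * Integer powers in a group *)

Section IntegerPowers.
Variable G : groupType.
Implicit Types (x : G) (k l : int).

Lemma expgzS x k : expgz x (k + 1) = (expgz x k * x)%g.
Proof.
case: k => [n|[|n]].
- by rewrite -PoszD addn1 /= expgSr.
- by rewrite /= expg1 mulVg.
- have -> : Negz n.+1 + 1 = Negz n by lia.
  by rewrite /= [in RHS]expgS invgM mulgVK.
Qed.

Lemma expgzD x k l : expgz x (k + l) = (expgz x k * expgz x l)%g.
Proof.
elim/int_ind: l => [|n IHn|n IHn]; first by rewrite addr0 mulg1.
  by rewrite -addn1 PoszD addrA !expgzS IHn mulgA.
apply: (@mulIg _ x); rewrite -mulgA -!expgzS -addrA.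
by have -> : - n.+1%:Z + 1 = - n%:Z by lia.
Qed.

Lemma expgzN x k : expgz x (- k) = (expgz x k)^-1%g.
Proof. by apply/esym/mulg1_eq; rewrite -expgzD subrr. Qed.

Lemma expgz_commute x y k : commute x y -> commute x (expgz y k).
Proof. by case: k => n xy /=; [|apply: commuteV]; apply: commuteX. Qed.

End IntegerPowers.

(** * Generated subgroups *)

Section SubgroupGen.
Variables (G : groupType) (A : set G).

Lemma subgroup_gen_in x : A x -> subgroup_gen A x.
Proof. by move=> Ax H [_]; apply. Qed.

Lemma subgroup_gen1 : subgroup_gen A 1%g.
Proof. by have [/set_mem] := subgroup_gen_closed A. Qed.

Lemma subgroup_genF x y :
  subgroup_gen A x -> subgroup_gen A y -> subgroup_gen A (x / y)%g.
Proof.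
have [_ F] := subgroup_gen_closed A => xA yA.
by apply/set_mem/F; apply/mem_set.
Qed.

Lemma subgroup_gen_min (H : set G) : H 1%g ->
    (forall x y, H x -> H y -> H (x / y)%g) -> A `<=` H ->
  subgroup_gen A `<=` H.
Proof.
move=> H1 HF AH x; apply; split=> //; split=> [|u v /set_mem Hu /set_mem Hv].
  exact/mem_set.
exact/mem_set/HF.
Qed.

End SubgroupGen.

(** * Congruence modulo a central subgroup *)

Section CentralCongruence.
Variable G : groupType.
Local Open Scope group_scope.

Definition central (z : G) := forall x, commute z x.

Definition central_subgroup (A : set G) :=
  [/\ A 1, forall x y, A x -> A y -> A (x / y) & A `<=` central].

Lemma central1 : central 1.
Proof. by move=> x; apply/commute_sym/commute1. Qed.

Lemma centralF x y : central x -> central y -> central (x / y).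
Proof.
move=> xC yC u; apply/commute_sym/commuteM; first exact/commute_sym.
by apply/commuteV/commute_sym.
Qed.

Lemma subgroup_gen_central (A : set G) : A `<=` central ->
  central_subgroup (subgroup_gen A).
Proof.
move=> AC; split; [exact: subgroup_gen1 | exact: subgroup_genF | ].
exact: subgroup_gen_min central1 centralF AC.
Qed.

Variable (A : set G).
Hypothesis csA : central_subgroup A.

(** Computations modulo A are carried out with this relation in the group itself; no quotient group
    is formed. *)
Definition eqmod x y := A (x / y).

Lemma csubV x : A x -> A x^-1.
Proof. by have [A1 AF _] := csA => /(AF _ _ A1); rewrite mul1g. Qed.

Lemma csubM x y : A x -> A y -> A (x * y).
Proof. by have [_ AF _] := csA => Ax /csubV /(AF _ _ Ax); rewrite invgK. Qed.

Lemma eqmodxx x : eqmod x x.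
Proof. by have [A1 _ _] := csA; rewrite /eqmod mulgV. Qed.

Lemma eqmod_sym x y : eqmod x y -> eqmod y x.
Proof. by move/csubV; rewrite invgF. Qed.

Lemma eqmod_trans y x z : eqmod x y -> eqmod y z -> eqmod x z.
Proof. by move=> xy /(csubM xy); rewrite divgKA. Qed.

(** The factor x' / y' is central, so it can be moved out from between x and the inverse of y. *)
Lemma eqmodM x y x' y' : eqmod x y -> eqmod x' y' -> eqmod (x * x') (y * y').
Proof.
have [_ _ AC] := csA => xy xy'; rewrite /eqmod invgM mulgA -[x * x' / y']mulgA.
rewrite -(AC _ xy' x) -mulgA; exact: csubM.
Qed.

Lemma eqmod1 x : eqmod x 1 <-> A x.
Proof. by rewrite /eqmod divg1. Qed.

Lemma eqmodMl a x : A a -> eqmod (a * x) x.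
Proof. by move=> Aa; rewrite /eqmod mulgK. Qed.

(** The element x y (y x)^-1 and the commutator are conjugate under y x, and conjugation fixes the
    central elements of A. *)
Lemma eqmod_commg x y : eqmod (x * y) (y * x) <-> A [~ x, y].
Proof.
have [_ _ AC] := csA; split=> [xy|Axy]; last first.
  by rewrite /eqmod (commgC x y) -(AC _ Axy) mulgK.
have : A ((x * y / (y * x)) ^ (y * x)).
  by rewrite conjgE [_ / _ * _](AC _ xy) mulKg.
by rewrite conjgE mulgVK commgEl conjgE invgM !mulgA.
Qed.

Lemma eqmod_prod (I : Type) (r : seq I) (P : pred I) (F H : I -> G) :
  (forall i, P i -> eqmod (F i) (H i)) ->
  eqmod (\prod_(i <- r | P i) F i) (\prod_(i <- r | P i) H i).
Proof. exact: (big_ind2 eqmod (eqmodxx 1) eqmodM). Qed.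

Lemma eqmod_prod_commute (I : Type) (r : seq I) (P : pred I) (F : I -> G) x :
  (forall i, eqmod (F i * x) (x * F i)) ->
  eqmod ((\prod_(i <- r | P i) F i) * x) (x * \prod_(i <- r | P i) F i).
Proof.
move=> Fx; elim/big_rec: _ => [|i y _ IH].
  by rewrite mul1g mulg1; apply: eqmodxx.
rewrite -mulgA; apply: eqmod_trans (eqmodM (eqmodxx _) IH) _.
by rewrite !mulgA; apply: eqmodM (eqmodxx _).
Qed.

Lemma eqmod_prodM (I : Type) (r : seq I) (P : pred I) (F H : I -> G) :
  (forall i j, eqmod (F i * H j) (H j * F i)) ->
  eqmod ((\prod_(i <- r | P i) F i) * \prod_(i <- r | P i) H i)
        (\prod_(i <- r | P i) (F i * H i)).
Proof.
move=> FH; elim: r => [|i r IHr]; first by rewrite !big_nil mulg1; apply: eqmodxx.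
rewrite !big_cons; case: (P i) => //.
(* In the intermediate term [H i] has been moved in front of the remaining factors [F j]. *)
apply: (eqmod_trans (y := F i * (H i * \prod_(j <- r | P j) F j) *
                      \prod_(j <- r | P j) H j)); last first.
  by rewrite (mulgA (F i)) -(mulgA (F i * H i)); apply: eqmodM (eqmodxx _) IHr.
rewrite -!mulgA; apply: eqmodM (eqmodxx _) _; rewrite !mulgA.
by apply: eqmodM (eqmodxx _); apply: eqmod_prod_commute.
Qed.

End CentralCongruence.

(** * Translations and central elements in a group generated by involutions w_x *)

Section CoreGroup.
Variables (G : groupType) (V : zmodType) (S : set V) (w : V -> G).
Local Open Scope group_scope.
Hypothesis S0 : S 0%R.
Hypothesis S_D2 : forall x y, S x -> S y -> S (x + y *+ 2)%R.
Hypothesis S_B2 : forall x y, S x -> S y -> S (x - y *+ 2)%R.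
Hypothesis wK : forall x, S x -> w x * w x = 1.
Hypothesis wJ : forall x y, S x -> S y -> w x * w y * w x = w (x *+ 2 - y)%R.
Hypothesis w_ind : forall P : G -> Prop,
  P 1 -> (forall x u, S x -> P u -> P (w x * u)) -> forall u, P u.

(** Conjugation by u shifts the index of each generator by 2l. The membership clause lets such
    statements be composed. *)
Definition translates (u : G) (l : V) := forall y, S y ->
  S (y + l *+ 2)%R /\ u * w y = w (y + l *+ 2)%R * u.

Definition transl x := w x * w 0%R.

Lemma S_N x : S x -> S (- x)%R.
Proof.
by move=> Sx; have := S_B2 Sx Sx; rewrite mulr2n opprD addrA subrr add0r.
Qed.

Lemma wV x : S x -> (w x)^-1 = w x.
Proof. by move=> Sx; apply: mulg1_eq; apply: wK. Qed.

Lemma w_translC x y : S x -> S y -> w x * w y = w (x *+ 2 - y)%R * w x.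
Proof. by move=> Sx Sy; rewrite -wJ // -mulgA wK // mulg1. Qed.

Lemma translates1 : translates 1 0.
Proof. by move=> y Sy; rewrite mul0rn addr0 mul1g mulg1. Qed.

Lemma translatesM u v l m :
  translates u l -> translates v m -> translates (u * v) (l + m)%R.
Proof.
move=> ul vm y Sy; have [Sy' E] := vm y Sy; have [Sy'' E'] := ul _ Sy'.
have F : (y + (l + m) *+ 2 = y + m *+ 2 + l *+ 2)%R.
  by rewrite mulrnDl addrA addrAC.
by rewrite F; split=> //; rewrite -mulgA E mulgA E' mulgA.
Qed.

Lemma translates_central u : translates u 0%R -> central u.
Proof.
move=> ul; apply: w_ind => [|x v Sx uv]; first exact: commute1.
by apply: commuteM => //; have [_] := ul x Sx; rewrite mul0rn addr0.
Qed.

(** Conjugation by w_0 sends the index y to -y, and conjugation by w_x sends -y to y + 2x. *)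
Lemma translates_transl x : S x -> translates (transl x) x.
Proof.
move=> Sx y Sy; split; first exact: S_D2.
have SNy := S_N Sy.
rewrite /transl -mulgA (w_translC S0 Sy) mul0rn sub0r !mulgA (w_translC Sx SNy).
by rewrite opprK addrC.
Qed.

Lemma translV x : S x -> (transl x)^-1 = w 0%R * w x.
Proof. by move=> Sx; rewrite invgM !wV. Qed.

Lemma translates_translV x : S x -> translates (transl x)^-1 (- x)%R.
Proof.
move=> Sx y Sy; rewrite translV // mulNrn; split; first exact: S_B2.
have Sxy : S (x *+ 2 - y)%R by rewrite addrC; apply: S_D2 => //; apply: S_N.
rewrite -mulgA (w_translC Sx Sy) !mulgA (w_translC S0 Sxy).
by rewrite mul0rn sub0r opprB.
Qed.

Lemma translatesX u l n : translates u l -> translates (u ^+ n) (l *+ n)%R.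
Proof.
move=> ul; elim: n => [|n IHn]; first exact: translates1.
by rewrite expgS mulrS; apply: translatesM.
Qed.

Lemma translates_expgz u l k : translates u l -> translates u^-1 (- l)%R ->
  translates (expgz u k) (l *~ k)%R.
Proof.
move=> ul uVl; case: k => n /=; first exact: translatesX.
by rewrite -expVgn NegzE mulrNz -mulNrz; apply: translatesX.
Qed.

Lemma translates_prod (I : Type) (r : seq I) (P : pred I) u l :
  (forall i, P i -> translates (u i) (l i)) ->
  translates (\prod_(i <- r | P i) u i) (\sum_(i <- r | P i) l i)%R.
Proof.
move=> ul; elim/big_ind2: _ => //; first exact: translates1.
by move=> *; apply: translatesM.
Qed.

(** The four translations -x, -y, x and y add up to zero. *)
Lemma transl_commg_central x y : S x -> S y ->
  central [~ transl x, transl y].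
Proof.
move=> Sx Sy; apply: translates_central.
rewrite commgEl conjgE.
have := translatesM (translates_translV Sx) (translatesM (translates_translV Sy)
  (translatesM (translates_transl Sx) (translates_transl Sy))).
by rewrite [(- x + _)%R]addrA -opprD addNr.
Qed.

(** A product of two involutions is inverted by conjugation with either of them. *)
Lemma transl_conj0 x : S x -> transl x ^ w 0%R = (transl x)^-1.
Proof. by move=> Sx; rewrite conjgE wV // translV // /transl -!mulgA wK // mulg1. Qed.

Variables (I : Type) (r : seq I) (P : pred I) (s : I -> V).
Hypothesis Ss : forall i, S (s i).

Definition zelt x := w 0%R * w x * \prod_(i <- r | P i) transl (s i).

(** [zelt x] is [(transl x)^-1 * \prod transl (s i)], which translates by
    [- x + \sum s i = 0]. *)
Lemma zelt_central x : S x -> x = (\sum_(i <- r | P i) s i)%R -> central (zelt x).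
Proof.
move=> Sx xE; apply: translates_central.
rewrite /zelt -translV //.
rewrite -[0%R](addNr x) {3}xE; apply: translatesM (translates_translV Sx) _.
by apply: translates_prod => i _; apply: translates_transl.
Qed.

(** Let p be the product of the [transl (s i)] and z = [zelt x]. Conjugation by w_0 inverts each
    factor of p in place. As z is central, p = w_x w_0 z, so the conjugate of p is w_0 w_x z, and
    multiplying it by p gives z^2. *)
Lemma zelt_sqr x : S x -> x = (\sum_(i <- r | P i) s i)%R ->
  zelt x ^+ 2 = (\prod_(i <- r | P i) (transl (s i))^-1) *
                \prod_(i <- r | P i) transl (s i).
Proof.
move=> Sx xE; have zC := zelt_central Sx xE.
rewrite -(eq_bigr _ (fun i _ => transl_conj0 (Ss i))) -conjg_prod.
set p := \prod_(i <- r | P i) _.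
have: zelt x = w 0%R * w x * p by [].
move: (zelt x) zC => z zC zE.
have pE : p = w x * w 0%R * z.
  by rewrite zE !mulgA -(mulgA (w x)) wK // mulg1 wK // mul1g.
rewrite conjgE wV // {1}pE -!mulgA [z * _]zC !mulgA.
rewrite -(mulgA _ (w 0%R) (w 0%R)) wK // mulg1.
by rewrite expg2 {1}zE.
Qed.

End CoreGroup.

(** * The Heisenberg group of isometries *)

Section HeisenbergAction.
Variables (R : realType) (V0 : vectType R) (nu : nat) (sigma : 'I_nu -> V0).
Implicit Types (n m : 'cV[R]_nu) (B C : 'M[R]_nu) (g h : orth V0) (u : Vt V0).

Definition lincomb n : V0 := \sum_i n i 0 *: sigma i.

Lemma lincomb_is_linear : linear lincomb.
Proof.
move=> a n m; rewrite /lincomb scaler_sumr -big_split /=.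
by apply: eq_bigr => i _; rewrite !mxE scalerDl scalerA.
Qed.

HB.instance Definition _ :=
  GRing.isLinear.Build R 'cV[R]_nu V0 *:%R lincomb lincomb_is_linear.

Definition values (f : 'Hom(V0, R^o)) : 'cV[R]_nu := \col_j f (sigma j).

Definition outer n m : 'M[R]_nu := \matrix_(i, j) (n i 0 * m j 0).

(** Composition multiplies these maps like elements of a Heisenberg group, see
    [heisM]; [B] is the central coordinate. *)
Definition heis n B u : Vt V0 :=
  ((u.1.1 - u.2 (lincomb n),
    u.1.2 + (2 * (u.1.1 : R)) *: lincomb n + lincomb (B *m values u.2)), u.2).

Lemma lfun_lincomb (f : 'Hom(V0, R^o)) n :
  f (lincomb n) = \sum_i n i 0 * values f i 0.
Proof. by rewrite linear_sum; apply: eq_bigr => i _; rewrite linearZ !mxE. Qed.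

Lemma outer_values n m (f : 'Hom(V0, R^o)) :
  outer n m *m values f = (f (lincomb m) : R) *: n.
Proof.
apply/matrixP => i j; rewrite !mxE lfun_lincomb big_distrl /= ord1.
by apply: eq_bigr => k _; rewrite !mxE -mulrA mulrC.
Qed.

(** The cocycle -2 n m^T arises because the inner map lowers the [alpha1]-coordinate by the value of
    the form on [lincomb m], and the outer map adds twice that coordinate times [lincomb n]. *)
Lemma heisM n m B C u :
  heis n B (heis m C u) = heis (n + m) (B + C - 2 *: outer n m) u.
Proof.
case: u => [[a x] f]; rewrite /heis /=; congr (((_, _), _)).
  rewrite (linearD lincomb) (linearD f). by rewrite opprD addrA addrAC.
rewrite mulmxBl mulmxDl -scalemxAl outer_values (linearB lincomb).
rewrite !(linearD lincomb) !linearZ /= scalerDr mulrBr scalerBl scalerA scalerN.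
have E (x' p q b c d : V0) :
    x' + q + c + (p - d) + b = x' + (p + q) + (b + c - d).
  rewrite -!addrA; congr (_ + _); rewrite [RHS]addrCA; congr (_ + _).
  rewrite addrCA; congr (_ + _); by rewrite addrA [RHS]addrC.
exact: E.
Qed.

Lemma heis_id u : heis 0 0 u = u.
Proof.
case: u => [[a x] f].
by rewrite /heis /= mul0mx !linear0 !addr0.
Qed.

Definition acts g n B := forall u, orth_fun g u = heis n B u.

Lemma acts1 : acts 1%g 0 0.
Proof. by move=> u; rewrite orth_oneE heis_id. Qed.

Lemma actsM g h n m B C : acts g n B -> acts h m C ->
  acts (g * h)%g (n + m) (B + C - 2 *: outer n m).
Proof. by move=> gB hC u; rewrite orth_mulE hC gB heisM. Qed.

Lemma actsM0 g h n B C : acts g 0 B -> acts h n C -> acts (g * h)%g n (B + C).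
Proof.
move=> gB hC; have := actsM gB hC; rewrite add0r.
have -> : outer 0 n = 0 by apply/matrixP => i j; rewrite !mxE mul0r.
by rewrite scaler0 subr0.
Qed.

(** The correction -2 n n^T cancels the cocycle of n against -n. *)
Lemma actsV g n B : acts g n B -> acts g^-1%g (- n) (- B - 2 *: outer n n).
Proof.
move=> gB u; set h := heis _ _ u.
have gh : orth_fun g h = u.
  rewrite gB heisM subrr -[RHS]heis_id; congr heis.
  by apply/matrixP => i j; rewrite !mxE; ring.
by rewrite -[in LHS]gh -orth_mulE mulVg orth_oneE.
Qed.

Lemma actsV0 g B : acts g 0 B -> acts g^-1%g 0 (- B).
Proof.
move=> gB; have := actsV gB; rewrite oppr0.
have -> : outer 0 0 = 0 by apply/matrixP => i j; rewrite !mxE mul0r.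
by rewrite scaler0 subr0.
Qed.

Lemma acts_commg g h n m B C : acts g n B -> acts h m C ->
  acts [~ g, h]%g 0 (2 *: (outer m n - outer n m)).
Proof.
(* The commutator is (h g)^-1 (g h), and both products have vector part n + m, so only the
   difference of their cocycles remains. *)
move=> gB hC; have := actsM (actsV (actsM hC gB)) (actsM gB hC).
rewrite invgM -mulgA (mulgA h^-1%g) -[((h^-1 * g) * h)%g]mulgA -conjgE -commgEl.
rewrite [m + n]addrC addNr; congr acts.
by apply/matrixP => i j; rewrite !mxE; ring.
Qed.

Lemma actsX0 g B k : acts g 0 B -> acts (g ^+ k)%g 0 (B *+ k).
Proof.
move=> gB; elim: k => [|k IHk]; first exact: acts1.
by rewrite expgS mulrS; apply: actsM0.
Qed.

Lemma acts_expgz0 g B k : acts g 0 B -> acts (expgz g k) 0 (B *~ k).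
Proof.
by case: k => k gB /=; [apply: actsX0 | apply/actsV0/actsX0].
Qed.

(** The central coordinate stays existential, since [ker_psi_hat_Z] reads off only the vector
    part. *)
Lemma acts_expgz g n B k : acts g n B ->
  exists C, acts (expgz g k) (n *~ k) C.
Proof.
have X l : acts g n B -> exists C, acts (g ^+ l)%g (n *+ l) C.
  move=> gB; elim: l => [|l [C hC]]; first by exists 0; apply: acts1.
  by rewrite expgS mulrS; eexists; apply: actsM gB hC.
move=> gB; case: k => k /=; first exact: X.
by have [C hC] := X k.+1 gB; eexists; apply: actsV hC.
Qed.

Lemma acts_prod0 (I : Type) (r : seq I) (P : pred I) (g : I -> orth V0)
    (B : I -> 'M_nu) :
  (forall i, P i -> acts (g i) 0 (B i)) ->
  acts (\prod_(i <- r | P i) g i)%g 0 (\sum_(i <- r | P i) B i).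
Proof.
move=> gB; elim/big_ind2: _ => //; first exact: acts1.
by move=> *; apply: actsM0.
Qed.

Lemma acts_prod (I : Type) (r : seq I) (P : pred I) (g : I -> orth V0)
    (n : I -> 'cV_nu) :
  (forall i, P i -> exists B, acts (g i) (n i) B) ->
  exists B, acts (\prod_(i <- r | P i) g i)%g (\sum_(i <- r | P i) n i) B.
Proof.
move=> gB; elim/big_ind2: _ => //; first by exists 0; apply: acts1.
by move=> x1 x2 y1 y2 [B hB] [C hC]; eexists; apply: actsM hB hC.
Qed.

Hypothesis sigma_basis : basis_of {:V0} [tuple sigma i | i < nu].

Definition dual (j : 'I_nu) : 'Hom(V0, R^o) :=
  linfun (coord [tuple sigma i | i < nu] j : V0 -> R^o).

Lemma dualE i j : dual i (sigma j) = (i == j)%:R.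
Proof.
rewrite lfunE /= eq_sym; have := coord_free j i (basis_free sigma_basis).
by rewrite -tnth_nth tnth_mktuple.
Qed.

Lemma dual_lincomb i n : dual i (lincomb n) = n i 0.
Proof.
rewrite lfun_lincomb (bigD1 i) //= big1 => [|j ji]; rewrite mxE dualE.
  by rewrite eqxx mulr1 addr0.
by rewrite eq_sym (negPf ji) mulr0.
Qed.

Lemma lincomb_inj : injective lincomb.
Proof.
by move=> n m nm; apply/matrixP => i j; rewrite ord1 -!dual_lincomb nm.
Qed.

(** At the form [dual j] the action shifts the [alpha1]-coordinate by -n_j and, once n = 0, shifts
    the V0-component by the combination of the [sigma i] given by column j of B. *)
Lemma acts_id n B : acts 1%g n B -> n = 0 /\ B = 0.
Proof.
move=> H; have n0 : n = 0.
  apply/matrixP => i j; rewrite ord1 mxE -dual_lincomb.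
  have := H ((0, 0), dual i); rewrite orth_oneE => -[/eqP].
  by rewrite add0r eq_sym oppr_eq0 => /eqP.
split=> //; apply/matrixP => i j.
have := H ((0, 0), dual j); rewrite orth_oneE n0 /heis /= !linear0 => -[_ /eqP].
rewrite !add0r eq_sym -(linear0 lincomb) => /eqP/lincomb_inj/matrixP.
move=> /(_ i 0); rewrite !mxE (bigD1 j) //= big1 => [|k kj].
  by rewrite mxE dualE eqxx mulr1 addr0.
by rewrite mxE dualE eq_sym (negPf kj) mulr0.
Qed.

End HeisenbergAction.

(** * The presented group of a semilattice and its map to the isometries *)

Section SemilatticeReflections.
Variables (R : realType) (V0 : vectType R) (S : set V0).
Hypothesis semiS : semilattice S.
Local Open Scope group_scope.
Implicit Types (a b c : Rx S) (x y : V0).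

Definition hat_w x : what S := what_gen S (alpha1 V0 + iso x)%R.

Notation gen := (pres_gen (@what_rel R V0 S)).

Lemma semilattice0 : S 0%R. Proof. by case: semiS. Qed.

Lemma semilatticeD2 x y : S x -> S y -> S (x + y *+ 2)%R.
Proof. by case: semiS => _ H _ _ Sx /(H x _ Sx)[]. Qed.

Lemma semilatticeB2 x y : S x -> S y -> S (x - y *+ 2)%R.
Proof. by case: semiS => _ H _ _ Sx /(H x _ Sx)[]. Qed.

Let S0 := semilattice0.
Let SD2 := semilatticeD2.
Let SB2 := semilatticeB2.
Let SN x (Sx : S x) : S (- x)%R := S_N SB2 Sx.

Lemma gen_sqr a : gen a * gen a = 1 :> what S.
Proof.
by rewrite [LHS]pres_classM; apply/pres_classP/word_eq_rel; constructor.
Qed.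

Lemma gen_conj a b c : val c = reflection (val a) (val b) ->
  gen a * gen b * gen a = gen c :> what S.
Proof.
move=> cE; rewrite [gen a * gen b]pres_classM [LHS]pres_classM.
by apply/pres_classP/word_eq_rel; constructor.
Qed.

(** Reflecting a in itself gives -a, so the conjugation relation for the pair (a, a) identifies the
    two generators. *)
Lemma gen_opp a b : val b = (- val a)%R -> gen b = gen a.
Proof.
move=> ba; have := @gen_conj a a b; rewrite gen_sqr mul1g => -> //.
by rewrite ba /reflection Rx_norm scaler_nat mulr2n opprD addrA subrr sub0r.
Qed.

Lemma w_gen x : S x -> exists2 a, val a = (alpha1 V0 + iso x)%R & hat_w x = gen a.
Proof.
move=> Sx; have xR : (alpha1 V0 + iso x)%R \in Rx S.
  by apply/mem_set; rewrite RxE; left; exists x.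
by exists (exist (fun v => v \in Rx S) _ xR) => //; rewrite /hat_w /what_gen insubT.
Qed.

Lemma iso_opp x : (- (alpha1 V0 + iso x) = - alpha1 V0 + iso (- x))%R.
Proof. by rewrite opprD; congr (_ + _)%R; rewrite /iso; congr ((_, _), _); rewrite oppr0. Qed.

(** The root -alpha_1 + x is the negative of alpha_1 - x, so the roots alpha_1 + S already index all
    generators. *)
Lemma gen_w a : exists2 x, S x & gen a = hat_w x.
Proof.
have := set_valP a; rewrite {1}RxE => -[[x Sx aE]|[x Sx aE]].
  exists x => //; have [b bE ->] := w_gen Sx; congr (gen _).
  by apply: val_inj; rewrite bE -aE.
exists (- x)%R; first exact: SN.
have [b bE ->] := w_gen (SN Sx); apply: gen_opp.
by rewrite bE -[val a]aE iso_opp opprK.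
Qed.

Lemma w_sqr x : S x -> hat_w x * hat_w x = 1.
Proof. by move=> /w_gen[a _ ->]; apply: gen_sqr. Qed.

Lemma reflectionE x (u : Vt V0) : (reflection (alpha1 V0 + iso x) u =
  ((- u.1.1 - u.2 x, u.1.2 - (2 * (u.1.1 : R) + u.2 x) *: x), u.2))%R.
Proof.
case: u => [[a y] f]; rewrite /reflection.
have -> : Defs.form (a, y, f) (alpha1 V0 + iso x)%R = (2 * (a : R) + f x)%R.
  by rewrite /Defs.form /= !addr0 !add0r mulr1 lfunE /= addr0.
congr ((_, _), _) => /=.
- rewrite addr0 [(_ *: _)%R]mulr1; ring.
- by rewrite add0r.
- by rewrite addr0 scaler0 subr0.
Qed.

Lemma reflection_alpha1 x y : (reflection (alpha1 V0 + iso x) (alpha1 V0 + iso y) =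
  - (alpha1 V0 + iso (x *+ 2 - y)))%R.
Proof.
rewrite reflectionE /= !addr0 !add0r lfunE /= subr0 addr0 mulr1 scaler_nat.
congr ((_, _), _) => /=; first by rewrite addr0.
  by rewrite add0r opprB.
by rewrite addr0 oppr0.
Qed.

Lemma w_conj x y : S x -> S y -> hat_w x * hat_w y * hat_w x = hat_w (x *+ 2 - y)%R.
Proof.
move=> Sx Sy; have Sxy : S (x *+ 2 - y)%R by rewrite addrC; apply: SD2 => //; apply: SN.
have [a aE ->] := w_gen Sx; have [b bE ->] := w_gen Sy.
have [c cE ->] := w_gen Sxy.
(* The reflected root is the negative of alpha_1 + 2x - y; [gen_opp] then returns to the positive
   one. *)
have cR : (- val c)%R \in Rx S.
  rewrite cE iso_opp; apply/mem_set; rewrite RxE; right.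
  by exists (- (x *+ 2 - y))%R => //; apply: SN.
pose d : Rx S := exist (fun v => v \in Rx S) _ cR.
rewrite (@gen_conj a b d); first exact: gen_opp.
by rewrite /= cE aE bE reflection_alpha1.
Qed.

Lemma w_ind (P : what S -> Prop) :
  P 1 -> (forall x u, S x -> P u -> P (hat_w x * u)) -> forall u, P u.
Proof.
move=> P1 PM u; rewrite -(pres_wordK u); elim: (pres_word u) => [|[a b] v IHv] //.
have -> : pres_class (@what_rel _ _ S) ((a, b) :: v) =
    gen a * pres_class (@what_rel _ _ S) v :> what S.
  case: b; first by rewrite [RHS]pres_classM.
  (* A formal inverse letter has the same class as the letter, since generators are involutions. *)
  have E : (gen a)^-1 = gen a :> what S by apply: mulg1_eq; apply: gen_sqr.
  by rewrite -E [X in _ = X * _]pres_invE [RHS]pres_classM.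
by have [x Sx ->] := gen_w a; apply: PM.
Qed.

(** Forgets membership in the Weyl group, so that [acts] applies to the value. *)
Definition weyl_of (u : what S) : orth V0 := val (psi u).

Lemma weyl_ofM : {morph weyl_of : u v / u * v}.
Proof. by move=> u v; rewrite /weyl_of psiM. Qed.

Lemma weyl_of1 : weyl_of 1 = 1.
Proof. by rewrite /weyl_of psi1. Qed.

HB.instance Definition _ :=
  isUMagmaMorphism.Build (what S) (orth V0) weyl_of (weyl_of1, weyl_ofM).

Lemma weyl_of_eq1 u : ker_psi S u <-> weyl_of u = 1.
Proof.
split=> [pu|u1]; first by rewrite /weyl_of [psi u]pu val1.
by apply: val_inj; rewrite val1.
Qed.

Lemma weyl_of_w x u : S x ->
  orth_fun (weyl_of (hat_w x)) u = reflection (alpha1 V0 + iso x)%R u.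
Proof. by move=> /w_gen[a aE ->]; rewrite /weyl_of psi_gen reflE aE. Qed.

Lemma weyl_of_transl x u : S x ->
  orth_fun (weyl_of (transl hat_w x)) u =
  ((u.1.1 - u.2 x, u.1.2 + (2 * (u.1.1 : R) - u.2 x) *: x), u.2)%R.
Proof.
move=> Sx; rewrite weyl_ofM orth_mulE !weyl_of_w // !reflectionE /=.
rewrite linear0 subr0 scaler0 subr0 opprK; congr ((_, _ + _), _)%R.
by rewrite -scaleNr mulrN opprD opprK.
Qed.

End SemilatticeReflections.

(** * Products in increasing order of indices *)

Section OrderedProducts.
Variable nu : nat.
Local Notation lt_ord := (fun i j : 'I_nu => (i < j)%N).

Lemma index_enum_ord_sorted : sorted lt_ord (index_enum 'I_nu).
Proof.
have := iota_ltn_sorted 0 nu.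
by rewrite -val_enum_ord sorted_map enumT.
Qed.

Lemma filter_ord_sorted (J : {set 'I_nu}) :
  sorted lt_ord [seq i <- index_enum 'I_nu | i \in J].
Proof.
apply: sorted_filter index_enum_ord_sorted => i j k; exact: ltn_trans.
Qed.

(** Strictly increasing lists with the same members are equal. *)
Lemma filter_ord_pair (r s : 'I_nu) : (r < s)%N ->
  [seq i <- index_enum 'I_nu | i \in [set r; s]%SET] = [:: r; s].
Proof.
move=> rs; apply: (@irr_sorted_eq _ lt_ord) => [i j k|i|||i].
- exact: ltn_trans.
- exact: ltnn.
- exact: filter_ord_sorted.
- by rewrite /= rs.
by rewrite mem_filter mem_index_enum andbT !inE.
Qed.

Lemma prod_ord_pair (G : groupType) (F : 'I_nu -> G) (r s : 'I_nu) : (r < s)%N ->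
  (\prod_(i < nu | i \in [set r; s]%SET) F i = F r * F s)%g.
Proof.
by move=> rs; rewrite -big_filter filter_ord_pair // !big_cons big_nil mulg1.
Qed.

End OrderedProducts.

(** * Powers of elements that commute modulo a central subgroup *)

Lemma eqmod_commuteV (G : groupType) (A : set G) (x y : G) : central_subgroup A ->
  eqmod A (x * y) (y * x) -> eqmod A (x^-1 * y) (y * x^-1).
Proof.
move=> csA xy; have := eqmodM csA (eqmodM csA (eqmodxx csA x^-1) (eqmod_sym csA xy))
  (eqmodxx csA x^-1).
by rewrite !mulgA mulgK mulVg mul1g.
Qed.

Lemma eqmod_commute_expgz (G : groupType) (A : set G) (x y : G) k :
    central_subgroup A -> eqmod A (x * y) (y * x) ->
  eqmod A (expgz x k * y) (y * expgz x k).
Proof.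
move=> csA xy; have X n : eqmod A (x ^+ n * y) (y * x ^+ n).
  elim: n => [|n IHn]; first by rewrite mul1g mulg1; apply: eqmodxx.
  rewrite expgS -mulgA. apply: (eqmod_trans csA (eqmodM csA (eqmodxx csA _) IHn) _).
  by rewrite !mulgA; apply: (eqmodM csA xy (eqmodxx csA _)).
by case: k => n /=; [| apply: (eqmod_commuteV csA _)]; apply: X.
Qed.

(** * The elements z_J and their centrality *)

Section CentralElements.
Variables (R : realType) (V0 : vectType R) (nu : nat) (S : set V0).
Variables (sigma : 'I_nu -> V0) (supp : {set {set 'I_nu}}).
Hypothesis dimV0 : \dim {:V0} = nu.
Hypothesis semiS : semilattice S.
Hypothesis sigmaS : forall i, S (sigma i).
Hypothesis sigma_Zbasis : Zbasis (Zspan S) sigma.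
Hypothesis suppS : is_supp S sigma supp.

Let S0 := semilattice0 semiS.
Let SD2 := semilatticeD2 semiS.
Let SB2 := semilatticeB2 semiS.
Let wK := @w_sqr R V0 S.
Let wJ := w_conj semiS.
Let wI := w_ind semiS.

Local Notation t r := (transl (hat_w S) (sigma r)).
Local Notation z := (hat_z S sigma supp).

Lemma Zspan_in x : S x -> Zspan S x.
Proof.
move=> Sx; exists 1%N, (fun=> x), [ffun=> 1]; split=> //.
by rewrite /Zcomb big_ord1 ffunE.
Qed.

Lemma Zspan0 : Zspan S 0.
Proof. exact: Zspan_in. Qed.

Lemma Zcomb_lincomb (c : {ffun 'I_nu -> int}) :
  Zcomb sigma c = lincomb sigma (\col_i (c i)%:~R).
Proof. by apply: eq_bigr => i _; rewrite mxE scaler_int. Qed.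

Lemma semilattice_Zcomb x : S x -> exists c, x = Zcomb sigma c.
Proof. by move=> /Zspan_in /(proj2 sigma_Zbasis)[c [xc _]]; exists c. Qed.

(** S spans V0 and consists of integer combinations of the [sigma i], so these nu vectors span a
    space of dimension nu. *)
Lemma sigma_basis : basis_of {:V0} [tuple sigma i | i < nu].
Proof.
rewrite basisEdim size_tuple dimV0 leqnn andbT.
have [_ _ [X XS <-] _] := semiS; apply/span_subvP => x /XS Sx.
have [c ->] := semilattice_Zcomb Sx; apply: memv_suml => i _.
rewrite -scaler_int; apply/memvZ/memv_span.
by rewrite -[sigma i]tnth_mktuple mem_tnth.
Qed.

Lemma tau_S J : J \in supp -> S (tau sigma J).
Proof.
move=> JS; have [_ ->] := suppS; exists J => //.
by exists 0; [exact: Zspan0 | rewrite mul0rn addr0].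
Qed.

Lemma alpha1_iso0 : alpha1 V0 + iso 0 = alpha1 V0.
Proof. by rewrite [iso 0](_ : _ = 0) ?addr0. Qed.

Lemma hat_tE r : hat_t S sigma r = t r.
Proof. by rewrite /hat_t /transl /hat_w alpha1_iso0. Qed.

Lemma hat_z_supp J : J \in supp ->
  z J = zelt (hat_w S) (index_enum 'I_nu) (mem J) sigma (tau sigma J).
Proof.
move=> Js; rewrite /hat_z Js /zelt {1}/hat_w alpha1_iso0.
by rewrite (eq_bigr _ (fun i _ => hat_tE i)).
Qed.

Lemma hat_z_pair (r s : 'I_nu) : (r < s)%N -> [set r; s]%SET \notin supp ->
  z [set r; s]%SET = [~ t r, t s]%g.
Proof.
move=> rs Ns; rewrite /hat_z (negPf Ns); case: pickP => [[a b]|/(_ (r, s))].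
  move=> /= /andP[ab /eqP E]; rewrite !hat_tE.
  (* The increasing enumeration of the set recovers the pair, so the pair picked is (r, s). *)
  have := filter_ord_pair rs; rewrite E filter_ord_pair // => -[-> ->] //.
by rewrite /= rs eqxx.
Qed.

Lemma hat_z_cases J : [\/ J \in supp,
  exists r s : 'I_nu, [/\ (r < s)%N, J = [set r; s]%SET & J \notin supp] | z J = 1%g].
Proof.
have [Js|Ns] := boolP (J \in supp); first by constructor 1.
have [[r s] /andP[/= rs /eqP JE]|H] :=
  pickP [pred p : 'I_nu * 'I_nu | (p.1 < p.2)%N && (J == [set p.1; p.2]%SET)].
  by constructor 2; exists r, s; rewrite -JE.
constructor 3; rewrite /hat_z (negPf Ns); case: pickP => // p.
by have /= -> := H p.
Qed.

Lemma hat_z_central J : central (z J).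
Proof.
have [Js|[r [s [rs -> Ns]]]|->] := hat_z_cases J; last exact: central1.
  by rewrite hat_z_supp //; apply: (zelt_central S0 SD2 SB2 wK wJ wI) (tau_S Js) _.
by rewrite hat_z_pair //; apply: (transl_commg_central S0 SD2 SB2 wK wJ wI).
Qed.

(** * The subgroup P spanned by the z_{r,s} *)

Definition pairs_prod (m : 'I_nu -> 'I_nu -> int) : what S :=
  (\prod_(p : 'I_nu * 'I_nu | (p.1 < p.2)%N)
      expgz (z [set p.1; p.2]%SET) (m p.1 p.2))%g.

Definition pairs_subgroup : set (what S) := range pairs_prod.

Lemma pairs_prodD m m' :
  pairs_prod (fun r s => m r s + m' r s) = (pairs_prod m * pairs_prod m')%g.
Proof.
rewrite -prodgM_commute => [|p q _ _]; last first.
  apply: expgz_commute; apply/commute_sym/expgz_commute; exact: hat_z_central.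
by apply: eq_bigr => p _; rewrite expgzD.
Qed.

Lemma pairs_prod0 m : (forall r s : 'I_nu, (r < s)%N -> m r s = 0) ->
  pairs_prod m = 1%g.
Proof. by move=> m0; apply: big1 => p /m0 ->. Qed.

Lemma pairs_subgroupP : central_subgroup pairs_subgroup.
Proof.
split=> [|_ _ [m _ <-] [m' _ <-]|_ [m _ <-] x].
- by exists (fun _ _ => 0) => //; apply: pairs_prod0.
- exists (fun r s => m r s - m' r s) => //.
  apply: (@mulIg _ (pairs_prod m')); rewrite mulgVK -pairs_prodD.
  by congr pairs_prod; apply/funext => r; apply/funext => s; rewrite subrK.
apply/commute_sym/commute_prod => p _; apply: expgz_commute.
exact/commute_sym/hat_z_central.
Qed.

Let csP := pairs_subgroupP.

Lemma hat_z_pairs (r s : 'I_nu) : (r < s)%N -> pairs_subgroup (z [set r; s]%SET).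
Proof.
move=> rs; exists (fun a b => ((a == r) && (b == s))%:Z) => //.
rewrite /pairs_prod (eq_bigr (fun p => if p == (r, s) then z [set r; s]%SET else 1%g)).
  rewrite -big_mkcondr (big_pred1 (r, s)) //= => -[a b] /=.
  by rewrite xpair_eqE; case: eqP => [->|_]; case: eqP => [->|_]; rewrite ?andbF ?rs.
move=> [a b] _; rewrite xpair_eqE /=.
by case: eqP => [->|_] //; case: eqP => [->|_].
Qed.

(** For r < s the commutator is z_{r,s}^2 by [zelt_sqr] if {r, s} is in the support, and z_{r,s}
    itself otherwise. *)
Lemma transl_commg_pairs r s : pairs_subgroup [~ t r, t s]%g.
Proof.
have lt (a b : 'I_nu) : (a < b)%N -> pairs_subgroup [~ t a, t b]%g.
  move=> ab; have [abs|Nab] := boolP ([set a; b]%SET \in supp); last first.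
    by rewrite -hat_z_pair //; apply: hat_z_pairs.
  have := hat_z_pairs ab; rewrite hat_z_supp // => zP.
  have := csubM csP zP zP; rewrite -expg2.
  rewrite (zelt_sqr S0 SD2 SB2 wK wJ wI) //; last exact: tau_S.
  rewrite !prod_ord_pair //; congr pairs_subgroup.
  by rewrite commgEl conjgE !mulgA.
case: (ltngtP r s) => [|sr|/val_inj ->]; first exact: lt.
  by rewrite -invgR; apply/(csubV csP)/lt.
by rewrite commgg; have [] := csP.
Qed.

Lemma transl_comm_pairs r s : eqmod pairs_subgroup (t r * t s)%g (t s * t r)%g.
Proof. exact/(eqmod_commg csP)/transl_commg_pairs. Qed.

Lemma hat_z_sqr_pairs J : pairs_subgroup (z J * z J)%g.
Proof.
have [Js|[r [s [rs -> Ns]]]|->] := hat_z_cases J; last first.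
- by rewrite mulg1; have [] := csP.
- by apply: csubM => //; apply: hat_z_pairs.
rewrite -expg2 hat_z_supp // (zelt_sqr S0 SD2 SB2 wK wJ wI) //; last exact: tau_S.
(* Modulo P the product of the inverses and the product of the t_r interleave and cancel factor by
   factor. *)
apply/eqmod1; apply: eqmod_trans => //.
  apply: eqmod_prodM => // i j; apply: eqmod_commuteV => //.
  exact: transl_comm_pairs.
by rewrite big1 => [|i _]; [apply: eqmodxx | rewrite mulVg].
Qed.


(** * Normal form of the elements of Z *)

Implicit Types (m : 'I_nu -> 'I_nu -> int) (eps : collection supp).

Definition eps_prod eps : what S :=
  (\prod_(J : {J : {set 'I_nu} | J \in Esupp supp}) z (val J) ^+ eps J)%g.

Lemma hat_uE m eps : hat_u S sigma m eps = (pairs_prod m * eps_prod eps)%g.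
Proof. by []. Qed.

Lemma eps_prod0 : eps_prod [ffun => false] = 1%g.
Proof. by apply: big1 => J _; rewrite ffunE. Qed.

(** Each z_J^2 lies in P, so exponents add modulo 2. *)
Lemma eps_prodM eps eps' : eqmod pairs_subgroup (eps_prod eps * eps_prod eps')%g
  (eps_prod [ffun J => eps J (+) eps' J]).
Proof.
rewrite /eps_prod -prodgM_commute => [|J J' _ _]; last first.
  by apply: commuteX; apply/commute_sym/commuteX/commute_sym/hat_z_central.
apply: eqmod_prod => // J _; rewrite ffunE.
case: (eps J) (eps' J) => [] [] /=; rewrite ?expg0 ?expg1 ?mulg1 ?mul1g;
  try exact: eqmodxx.
exact/eqmod1/hat_z_sqr_pairs.
Qed.

(** The elements [hat_u m eps], with m absorbed into the congruence modulo P. *)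
Definition eps_subgroup : set (what S) :=
  [set u | exists eps, eqmod pairs_subgroup u (eps_prod eps)].

Lemma eps_subgroup_sqr u : eps_subgroup u -> pairs_subgroup (u * u)%g.
Proof.
move=> [eps ue]; apply/eqmod1; apply: (eqmod_trans csP (eqmodM csP ue ue)).
rewrite -eps_prod0; apply: eqmod_trans (eps_prodM _ _) _ => //.
suff -> : [ffun J => eps J (+) eps J] = [ffun => false] by apply: eqmodxx.
by apply/ffunP => J; rewrite !ffunE addbb.
Qed.

Lemma eps_subgroupF u v : eps_subgroup u -> eps_subgroup v ->
  eps_subgroup (u / v)%g.
Proof.
move=> [eps ue] Qv; have := eps_subgroup_sqr Qv; case: Qv => eps' ve vv.
exists [ffun J => eps J (+) eps' J].
apply: eqmod_trans (eps_prodM _ _) => //; apply: eqmodM => //.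
(* Since v^2 lies in P, the inverse of v is congruent to v. *)
apply: eqmod_trans ve => //; apply: eqmod_sym => //.
by rewrite /eqmod invgK.
Qed.

(** For J = {r} the product reads w_0 w_x w_x w_0 with x = sigma_r, and for empty J it is w_0
    w_0. *)
Lemma hat_z_small J : J \in supp -> (#|J| <= 1)%N -> z J = 1%g.
Proof.
move=> Js; rewrite hat_z_supp // /zelt leq_eqVlt ltnS leqn0 cards_eq0.
case/orP => [/cards1P[r ->]|/eqP ->].
  rewrite /tau big_set1 (eq_bigl (pred1 r)) => [|i]; last by rewrite /= inE.
  by rewrite big_pred1_eq /transl -mulgA (mulgA (hat_w S (sigma r))) wK // mul1g wK.
by rewrite /tau big_set0 wK // big_pred0 ?mulg1 // => i /=; rewrite inE.
Qed.

Lemma hat_z_eps J : eps_subgroup (z J).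
Proof.
have P_eps u : pairs_subgroup u -> eps_subgroup u.
  by move=> Pu; exists [ffun => false]; rewrite eps_prod0; apply/eqmod1.
have [Js|[r [s [rs -> _]]]|->] := hat_z_cases J; last first.
- by apply: P_eps; have [] := csP.
- by apply: P_eps; apply: hat_z_pairs.
case: (ltngtP #|J| 2%N) => [J1|J3|/eqP J2].
- by rewrite hat_z_small //; apply: P_eps; have [] := csP.
- have JE : J \in Esupp supp by rewrite inE Js.
  pose J' : {J | J \in Esupp supp} := exist _ J JE.
  exists [ffun K => K == J']; rewrite /eps_prod.
  rewrite (eq_bigr (fun K => if K == J' then z J else 1%g)) => [|K _].
    by rewrite -big_mkcond /= big_pred1_eq; apply: eqmodxx.
  by rewrite ffunE; case: eqP => [->|].
apply: P_eps; have /cards2P[r [s [rs JE]]] := J2.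
have {rs} : (r : nat) != s by apply: contraNneq rs => /val_inj ->.
rewrite neq_ltn => /orP[rs|sr]; rewrite JE; first exact: hat_z_pairs.
by rewrite finset.setUC; apply: hat_z_pairs.
Qed.

Lemma hat_Z_eps : hat_Z S sigma supp `<=` eps_subgroup.
Proof.
apply: subgroup_gen_min => [||_ [J _ <-]]; last exact: hat_z_eps.
- by exists [ffun => false]; rewrite eps_prod0; apply: eqmodxx.
- exact: eps_subgroupF.
Qed.

Lemma hat_Z_sqr u : hat_Z S sigma supp u -> pairs_subgroup (u * u)%g.
Proof. by move/hat_Z_eps/eps_subgroup_sqr. Qed.

Lemma hat_Z_hat_u u : hat_Z S sigma supp u ->
  exists m eps, u = hat_u S sigma m eps.
Proof.
move=> /hat_Z_eps[eps [m _ me]]; exists m, eps.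
by rewrite hat_uE me mulgVK.
Qed.

Lemma csZ : central_subgroup (hat_Z S sigma supp).
Proof. by apply: subgroup_gen_central => _ [J _ <-]; apply: hat_z_central. Qed.

Lemma hat_z_Z J : hat_Z S sigma supp (z J).
Proof. by apply: subgroup_gen_in; exists J. Qed.

Lemma hat_Z_prod (I : Type) (r : seq I) (P : pred I) (F : I -> what S) :
  (forall i, P i -> hat_Z S sigma supp (F i)) ->
  hat_Z S sigma supp (\prod_(i <- r | P i) F i)%g.
Proof.
move=> FZ; elim/big_ind: _ => //; first by have [] := csZ.
by move=> x y Zx Zy; apply: (csubM csZ Zx Zy).
Qed.

Lemma pairs_subgroup_Z : pairs_subgroup `<=` hat_Z S sigma supp.
Proof.
move=> _ [m _ <-]; apply: hat_Z_prod => p _.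
have X n (u : what S) : hat_Z S sigma supp u -> hat_Z S sigma supp (u ^+ n)%g.
  by move=> uZ; rewrite -[n]subn0 -prodg_const_nat; apply: hat_Z_prod.
case: (m _ _) => n /=; first by apply: X; apply: hat_z_Z.
by apply: (csubV csZ); apply: X; apply: hat_z_Z.
Qed.


(** * The action of Z and the coefficients of its elements *)

Local Notation phi := (@weyl_of R V0 S).
Local Notation lt_ord := (fun i j : 'I_nu => (i < j)%N).

Definition indic_mx (A : {pred 'I_nu}) : 'cV[R]_nu := \col_i (i \in A)%:R.

(** The bivector \sum_(r < s in J) sigma_r /\ sigma_s. *)
Definition skew_mx (J : {set 'I_nu}) : 'M[R]_nu :=
  \matrix_(i, j) (((i \in J) && (j \in J))%:R * ((j < i)%N%:R - (i < j)%N%:R)).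

Lemma lincomb_delta r : lincomb sigma (delta_mx r 0) = sigma r.
Proof.
rewrite /lincomb (bigD1 r) //= big1 => [|j jr]; rewrite mxE.
  by rewrite !eqxx scale1r addr0.
by rewrite (negPf jr) scale0r.
Qed.

Lemma tauE J : tau sigma J = lincomb sigma (indic_mx (mem J)).
Proof.
rewrite /tau big_mkcond; apply: eq_bigr => i _; rewrite mxE.
by case: (i \in J); rewrite ?scale1r ?scale0r.
Qed.

Lemma acts_transl n : S (lincomb sigma n) ->
  acts sigma (phi (transl (hat_w S) (lincomb sigma n))) n (- outer n n).
Proof.
move=> Sn u; rewrite weyl_of_transl // /heis mulNmx outer_values.
by rewrite linearN linearZ /= -addrA -scaleNr -scalerDl.
Qed.

Lemma acts_hat_t r : acts sigma (phi (t r)) (delta_mx r 0)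
  (- outer (delta_mx r 0) (delta_mx r 0)).
Proof.
by have := @acts_transl (delta_mx r 0); rewrite lincomb_delta; apply.
Qed.

(** Central coordinate of an increasing product of the t_r: each t_r contributes -1 on the diagonal,
    and the cocycle contributes -2 above it. *)
Definition ordered_mx (s : seq 'I_nu) : 'M[R]_nu :=
  \matrix_(i, j) (- ((i \in s) && (i == j))%:R
                  - 2 * [&& i \in s, j \in s & (i < j)%N]%:R).

Lemma acts_ordered_prod (s : seq 'I_nu) : sorted lt_ord s ->
  acts sigma (phi (\prod_(r <- s) t r)%g) (indic_mx (mem s)) (ordered_mx s).
Proof.
elim: s => [_|r s IHs rs].
  rewrite big_nil weyl_of1.
  have -> : indic_mx (mem [::]) = 0 by apply/matrixP => i j; rewrite !mxE.
  have -> : ordered_mx [::] = 0.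
    by apply/matrixP => i j; rewrite !mxE mulr0 subr0 oppr0.
  exact: acts1.
have lt_trans : transitive lt_ord by move=> i j k; apply: ltn_trans.
have /allP r_lt := order_path_min lt_trans rs.
have r_s : r \notin s by apply/negP => /r_lt /=; rewrite ltnn.
rewrite big_cons weyl_ofM.
have := actsM (acts_hat_t r) (IHs (path_sorted rs)).
congr acts; apply/matrixP => i j; rewrite !mxE ?in_cons.
  rewrite ord1 eqxx andbT; case: (eqVneq i r) => [->|_] /=; last by rewrite add0r.
  by rewrite (negPf r_s) addr0.
rewrite !eqxx !andbT.
(* As r precedes every member of s, the new cocycle terms -2 fill row r only. *)
case: (eqVneq i r) => [->|ir] /=; case: (eqVneq j r) => [->|jr] /=.
- by rewrite (negPf r_s) ltnn /=; ring.
- rewrite (negPf r_s) /=.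
  by case: (boolP (j \in s)) => [/r_lt /= ->|_] /=; ring.
- rewrite (negPf r_s) (negPf ir) andbF /=.
  case: (boolP (i \in s)) => [/r_lt /=|_] /=; last by ring.
  by move=> ri; rewrite ltnNge (ltnW ri) /=; ring.
ring.
Qed.

(** With n the indicator of J, the inverse of the translation by tau_J times the ordered product has
    central coordinate n n^T + [ordered_mx]. On J x J this is 1 - 1 on the diagonal, 1 - 2 above it
    and 1 below it. *)
Lemma acts_hat_z_supp J : J \in supp -> acts sigma (phi (z J)) 0 (skew_mx J).
Proof.
move=> Js; rewrite hat_z_supp // /zelt -(translV S0 wK (tau_S Js)).
rewrite -big_filter weyl_ofM gmulfV.
have SJ := tau_S Js; rewrite tauE in SJ *.
have := actsM (actsV (acts_transl SJ)) (acts_ordered_prod (filter_ord_sorted J)).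
congr acts; apply/matrixP => i j; rewrite !mxE ?mem_filter ?mem_index_enum ?andbT.
  exact: addNr.
have [->|] := eqVneq i j; first by rewrite ltnn; case: (j \in J) => /=; ring.
rewrite -(inj_eq val_inj) /= => ij.
case: (i \in J) => /=; case: (j \in J) => /=; try ring.
by case: ltngtP ij => //= _ _; ring.
Qed.

Lemma skew_pair (r s : 'I_nu) : (r < s)%N ->
  outer (delta_mx s 0) (delta_mx r 0) - outer (delta_mx r 0) (delta_mx s 0) =
  skew_mx [set r; s]%SET.
Proof.
move=> rs; apply/matrixP => i j; rewrite !mxE !inE !eqxx !andbT.
have Nrs : r == s = false by apply/negbTE; rewrite -(inj_eq val_inj) /= ltn_eqF.
have Nsr : (s < r)%N = false by rewrite ltnNge ltnW.
case: (eqVneq i r) => [->|ir] /=; case: (eqVneq j r) => [->|jr] /=;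
  rewrite ?Nrs ?eqxx ?ltnn /=; try ring.
- by case: (eqVneq j s) => [->|js] /=; rewrite ?rs ?Nsr /=; ring.
- by case: (eqVneq i s) => [->|js] /=; rewrite ?rs ?Nsr /=; ring.
by case: (eqVneq i s) => [->|_] /=; case: (eqVneq j s) => [->|_] /=;
  rewrite ?ltnn /=; ring.
Qed.

Lemma acts_hat_z_pair (r s : 'I_nu) : (r < s)%N ->
  acts sigma (phi (z [set r; s]%SET)) 0
    ((delta supp r s)%:R *: skew_mx [set r; s]%SET).
Proof.
move=> rs; rewrite /delta; have [rss|Nrs] := boolP ([set r; s]%SET \in supp).
  by rewrite scale1r; apply: acts_hat_z_supp.
rewrite hat_z_pair // gmulfR -skew_pair //.
exact: acts_commg (acts_hat_t r) (acts_hat_t s).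
Qed.

Definition hat_u_mx m eps : 'M[R]_nu :=
  \sum_(p : 'I_nu * 'I_nu | (p.1 < p.2)%N)
    ((m p.1 p.2)%:~R * (delta supp p.1 p.2)%:R) *: skew_mx [set p.1; p.2]%SET +
  \sum_(J : {J : {set 'I_nu} | J \in Esupp supp}) (eps J)%:R *: skew_mx (val J).

Lemma weyl_of_expgz u k : phi (expgz u k) = expgz (phi u) k.
Proof. by case: k => k /=; rewrite ?gmulfV gmulfXn. Qed.

Lemma acts_hat_u m eps : acts sigma (phi (hat_u S sigma m eps)) 0 (hat_u_mx m eps).
Proof.
rewrite hat_uE weyl_ofM /pairs_prod /eps_prod !gmulf_prod.
apply: actsM0; apply: acts_prod0 => p lt_p.
  rewrite /= weyl_of_expgz -scalerA scaler_int; apply: acts_expgz0; exact: acts_hat_z_pair.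
rewrite /= gmulfXn scaler_nat; apply/actsX0/acts_hat_z_supp.
by have := valP p; rewrite inE => /andP[].
Qed.

(** Vanishing of all [coef m eps r s] is condition ( * ) cleared of denominators, see
    [coef_exps]. *)
Definition coef m eps (r s : 'I_nu) : int :=
  (delta supp r s)%:Z * m r s + \sum_J (deltaJ (val J) r s * eps J)%N%:Z.

Lemma skew_mxC J i j : skew_mx J j i = - skew_mx J i j.
Proof. by rewrite !mxE andbC -mulrN opprB. Qed.

Lemma hat_u_mxC m eps i j : hat_u_mx m eps j i = - hat_u_mx m eps i j.
Proof.
rewrite !mxE !summxE opprD; congr (_ + _); apply: etrans (sumrN _ _ _);
  by apply: eq_bigr => k _; rewrite mxE skew_mxC mulrN [in RHS]mxE.
Qed.

(** Among the pairs only {i, j} contributes to this entry. A larger J contributes when it contains i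
    and j, and the inclusion is then strict because J has at least three elements. *)
Lemma hat_u_mx_coef m eps (i j : 'I_nu) : (i < j)%N ->
  hat_u_mx m eps i j = - (coef m eps i j)%:~R.
Proof.
move=> ij; have ji : (j < i)%N = false by rewrite ltnNge ltnW.
rewrite mxE !summxE (bigD1 (i, j)) //= [X in _ + X + _]big1 => [|p]; last first.
  case: p => [a b] /= /andP[ab]; rewrite xpair_eqE => Nij.
  rewrite !mxE !inE; suff -> : ((i == a) || (i == b)) && ((j == a) || (j == b)) = false.
    by rewrite mul0r mulr0.
  apply/negP => /andP[/orP[] /eqP iE /orP[] /eqP jE]; move: ij ab Nij;
    rewrite iE jE ?ltnn ?eqxx //; by move=> /ltnW; rewrite leqNgt => /negPf ->.
rewrite !mxE !inE !eqxx orbT ij ji /= addr0 /coef rmorphD rmorphM /= opprD.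
congr (_ + _); first by rewrite -pmulrn; ring.
rewrite rmorph_sum; apply: etrans (sumrN _ _ _); apply: eq_bigr => J _.
rewrite !mxE ij ji /deltaJ /=.
have -> : [set i; j]%SET \proper val J = (i \in val J) && (j \in val J).
  rewrite properEcard finset.subUset !finset.sub1set; apply: andb_idr => _.
  have := valP J; rewrite inE => /andP[_]. apply: leq_trans.
  by rewrite cards2; case: (_ != _).
rewrite mulnC -pmulrn natrM; ring.
Qed.

(** The matrix is skew-symmetric, hence determined by its entries above the diagonal. *)
Lemma hat_u_mx_eq0 m eps : hat_u_mx m eps = 0 <->
  forall r s : 'I_nu, (r < s)%N -> coef m eps r s = 0.
Proof.
split=> [M0 r s rs|c0].
  have := hat_u_mx_coef m eps rs; rewrite M0 mxE => /eqP.
  by rewrite eq_sym oppr_eq0 intr_eq0 => /eqP.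
apply/matrixP => i j; rewrite [RHS]mxE.
have M0 (a b : 'I_nu) : (a < b)%N -> hat_u_mx m eps a b = 0.
  by move=> ab; rewrite hat_u_mx_coef // c0 // oppr0.
case: (ltngtP i j) => [|ji|/val_inj ->]; first exact: M0.
  by rewrite hat_u_mxC M0 // oppr0.
have /eqP := hat_u_mxC m eps j j.
by rewrite -addr_eq0 -mulr2n mulrn_eq0 => /eqP.
Qed.

Lemma hat_u_ker m eps : ker_psi S (hat_u S sigma m eps) <->
  forall r s : 'I_nu, (r < s)%N -> coef m eps r s = 0.
Proof.
have aM := acts_hat_u m eps; rewrite -hat_u_mx_eq0; split=> [/weyl_of_eq1 u1|M0].
  by rewrite u1 in aM; have [] := acts_id sigma_basis aM.
apply/weyl_of_eq1/orth_eqP => u; rewrite aM M0.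
by have := acts1 sigma u.
Qed.

(** The k-th power has k times the central coordinate, a real matrix, so the coordinate itself
    vanishes. *)
Lemma hat_u_torsion m eps k : (0 < k)%N -> (hat_u S sigma m eps ^+ k = 1)%g ->
  forall r s : 'I_nu, (r < s)%N -> coef m eps r s = 0.
Proof.
move=> k0 uk; apply/hat_u_mx_eq0.
have := actsX0 k (acts_hat_u m eps); rewrite -gmulfXn uk gmulf1.
move=> /(acts_id sigma_basis)[_ /eqP].
by rewrite -scaler_nat scaler_eq0 pnatr_eq0 -[k == 0]negbK -lt0n k0 => /eqP.
Qed.

Lemma delta_gt0 r s : (0 < delta supp r s)%N.
Proof. by rewrite /delta; case: ifP. Qed.

(** This is injectivity of psi on P: for epsilon = 0 the coefficient is delta(r, s) m_{r,s} with
    delta(r, s) positive. *)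
Lemma pairs_ker u : pairs_subgroup u -> ker_psi S u -> u = 1%g.
Proof.
move=> [m _ <-]; rewrite -[pairs_prod m]mulg1 -eps_prod0 -hat_uE => /hat_u_ker c0.
rewrite hat_uE eps_prod0 mulg1; apply: pairs_prod0 => r s rs.
have := c0 _ _ rs; rewrite /coef big1 => [/eqP|J _]; last by rewrite ffunE muln0.
rewrite addr0 mulf_eq0 => /orP[/eqP[d0]|/eqP //].
by have := delta_gt0 r s; rewrite d0.
Qed.

Lemma coef_exps m eps : exps_of m eps <->
  forall r s : 'I_nu, (r < s)%N -> coef m eps r s = 0.
Proof.
have E r s : ((m r s)%:~R == - eps_avg eps r s) = (coef m eps r s == 0).
  have d0 : (delta supp r s)%:R != 0 :> rat by rewrite pnatr_eq0 -lt0n delta_gt0.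
  rewrite -addr_eq0 -(inj_eq (mulfI d0)) mulr0 mulrDr /eps_avg mulVKf //.
  rewrite -(@intr_eq0 rat) /coef rmorphD rmorphM /= raddf_sum.
  by rewrite (eq_bigr (fun J => (deltaJ (val J) r s * eps J)%N%:R)).
by split=> H r s rs; apply/eqP; [rewrite -E | rewrite E]; apply/eqP/H.
Qed.

Lemma exps_of_integral m eps : exps_of m eps -> integral_collection eps.
Proof.
move=> me r s rs; rewrite -[eps_avg _ _ _]opprK -me // rpredN; exact: intr_int.
Qed.

(** * Normal form modulo Z, and the inclusion of the kernel in Z *)

Definition lattice_prod (n : 'I_nu -> int) : what S :=
  (\prod_(r < nu) expgz (t r) (n r))%g.

Local Notation Z := (hat_Z S sigma supp).
Local Notation w0 := (hat_w S 0).

Lemma expgz_transl_comm_Z r s k l : eqmod Z (expgz (t r) k * expgz (t s) l)%g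
  (expgz (t s) l * expgz (t r) k)%g.
Proof.
apply: (eqmod_commute_expgz k csZ _); apply: (eqmod_sym csZ _).
apply: (eqmod_commute_expgz l csZ _); apply: pairs_subgroup_Z.
exact: transl_comm_pairs.
Qed.

Lemma lattice_prodD n n' :
  eqmod Z (lattice_prod n * lattice_prod n')%g (lattice_prod (fun r => n r + n' r)).
Proof.
apply: (eqmod_trans csZ (eqmod_prodM csZ _ _ _) _) => [r s|].
  exact: expgz_transl_comm_Z.
rewrite [X in eqmod _ X _](eq_bigr (fun r => expgz (t r) (n r + n' r))).
  exact: eqmodxx csZ _.
by move=> r _; rewrite expgzD.
Qed.

Lemma lattice_prod0 n : (forall r, n r = 0) -> lattice_prod n = 1%g.
Proof. by move=> n0; apply: big1 => r _; rewrite n0. Qed.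

Lemma lattice_prodV n :
  eqmod Z (lattice_prod n)^-1%g (lattice_prod (fun r => - n r)).
Proof.
have := eqmodM csZ (eqmodxx csZ (lattice_prod n)^-1%g)
  (lattice_prodD n (fun r => - n r)).
have -> := @lattice_prod0 (fun r => n r - n r) (fun r => subrr (n r)).
by rewrite mulKg mulg1 => /(eqmod_sym csZ).
Qed.

(** Conjugation by w_0 inverts each t_r and keeps the order of the factors, so equality holds
    exactly and not only modulo Z. *)
Lemma lattice_prod_conj n :
  (w0 * lattice_prod n = lattice_prod (fun r => - n r) * w0)%g.
Proof.
have E : (lattice_prod n ^ w0 = lattice_prod (fun r => - n r))%g.
  rewrite /lattice_prod conjg_prod; apply: eq_bigr => r _.
  rewrite expgzN; case: (n r) => k /=; rewrite ?conjVg conjXg;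
    by rewrite (transl_conj0 S0 wK (sigmaS r)) expVgn.
by rewrite -E conjgE (wV wK S0) -mulgA -mulgA wK // mulg1.
Qed.

Lemma lattice_prod_indic (J : {set 'I_nu}) :
  lattice_prod (fun r => (r \in J)%:Z) = (\prod_(r < nu | r \in J) t r)%g.
Proof. by rewrite [RHS]big_mkcond; apply: eq_bigr => r _; case: (r \in J). Qed.

Lemma translates_lattice_prod (c : {ffun 'I_nu -> int}) :
  translates S (hat_w S) (lattice_prod c) (Zcomb sigma c).
Proof.
apply: translates_prod => r _; apply: translates_expgz.
  exact: (translates_transl S0 SD2 SB2 wK wJ).
exact: (translates_translV S0 SD2 SB2 wK wJ).
Qed.

Definition normal_form (u : what S) :=
  exists n (b : bool), eqmod Z u (lattice_prod n * w0 ^+ b)%g.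

Lemma normal_form_eqmod u v : eqmod Z u v -> normal_form v -> normal_form u.
Proof. by move=> uv [n [b vE]]; exists n, b; apply: (eqmod_trans csZ uv vE). Qed.

Lemma normal_form_lattice n u : normal_form u -> normal_form (lattice_prod n * u)%g.
Proof.
move=> [m [b uE]]; exists (fun r => n r + m r), b.
apply: (eqmod_trans csZ (eqmodM csZ (eqmodxx csZ _) uE) _); rewrite mulgA.
by apply: (eqmodM csZ (lattice_prodD n m) (eqmodxx csZ _)).
Qed.

Lemma normal_form_w0 u : normal_form u -> normal_form (w0 * u)%g.
Proof.
move=> [m [b uE]]; exists (fun r => - m r), (~~ b).
apply: (eqmod_trans csZ (eqmodM csZ (eqmodxx csZ _) uE) _).
rewrite mulgA lattice_prod_conj -mulgA.
have -> : (w0 * w0 ^+ b = w0 ^+ ~~ b)%g.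
  by case: (b); [exact: wK S0 | exact: mulg1].
exact: eqmodxx csZ _.
Qed.

(** With p the product of the t_r over J, z_J = w_0 w_x p for x = tau_J, so w_x = z_J w_0 p^-1 by
    centrality. *)
Lemma w_tau_Z J : J \in supp -> eqmod Z (hat_w S (tau sigma J))
  (w0 * lattice_prod (fun r => - (r \in J)%:Z))%g.
Proof.
move=> Js; set p := (\prod_(r < nu | r \in J) t r)%g.
have E : hat_w S (tau sigma J) = (z J * (w0 * p^-1))%g.
  have zC := hat_z_central J; rewrite mulgA [(z J * _)%g]zC hat_z_supp //.
  by rewrite /zelt -!mulgA mulgV mulg1 mulgA wK // mul1g.
rewrite E; apply: (eqmod_trans csZ (eqmodMl _ (hat_z_Z J)) _).
apply: (eqmodM csZ (eqmodxx csZ _) _).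
by rewrite /p -lattice_prod_indic; apply: lattice_prodV.
Qed.

Lemma normal_form_all u : normal_form u.
Proof.
elim/wI: u => [|x u Sx IHu].
  exists (fun=> 0), false; rewrite lattice_prod0 // mulg1; exact: (eqmodxx csZ _).
(* Writing x = tau_J + 2y, with c the coordinates of y, exhibits w_x as the conjugate by
   [lattice_prod c] of the generator at tau_J. *)
have [_ SE] := suppS; move: Sx; rewrite {1}SE => -[J Js [y /(proj2 sigma_Zbasis)]].
move=> [c [-> _]] <-; have [_ wE] := translates_lattice_prod c (tau_S Js).
have {wE} -> : hat_w S (tau sigma J + Zcomb sigma c *+ 2) =
    (lattice_prod c * hat_w S (tau sigma J) * (lattice_prod c)^-1)%g.
  by rewrite wE mulgK.
pose v := (lattice_prod c * (w0 * (lattice_prod (fun r => - (r \in J)%:Z) *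
  (lattice_prod (fun r => - c r) * u))))%g.
apply: (@normal_form_eqmod _ v).
  rewrite -!mulgA; apply: (eqmodM csZ (eqmodxx csZ _) _); rewrite [X in eqmod _ _ X]mulgA.
  apply: (eqmodM csZ (w_tau_Z Js) _); apply: (eqmodM csZ _ (eqmodxx csZ _)).
  exact: lattice_prodV.
apply/normal_form_lattice/normal_form_w0/normal_form_lattice.
exact: normal_form_lattice.
Qed.

Lemma ker_psi_hat_Z : ker_psi S `<=` Z.
Proof.
move=> u uker; have [n [b ub]] := normal_form_all u.
have [a [Za uE]] : exists a, Z a /\ u = (a * lattice_prod n * w0 ^+ b)%g.
  by exists (u / (lattice_prod n * w0 ^+ b))%g; split; rewrite // -mulgA mulgVK.
have [m [eps aE]] := hat_Z_hat_u Za; have := acts_hat_u m eps; rewrite -aE => aA.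
pose d r : 'cV[R]_nu := delta_mx r 0 *~ n r.
have [B nB] : exists B, acts sigma (phi (lattice_prod n)) (\sum_r d r) B.
  rewrite gmulf_prod; apply: acts_prod => r _; rewrite /= weyl_of_expgz.
  exact: acts_expgz (acts_hat_t r).
have anB := actsM0 aA nB; rewrite -weyl_ofM in anB.
have u1 : phi u = 1%g by apply/weyl_of_eq1.
case: b ub uE => [_ uE|_ uE].
  (* A factor w_0 sends the [alpha1]-coordinate 1 of [alpha1] to -1, and the other two factors do
     not change it, so u could not act trivially. *)
  have := congr1 (fun g => (orth_fun g (alpha1 V0)).1.1 : R) u1.
  rewrite orth_oneE uE weyl_ofM orth_mulE expg1 weyl_of_w // anB reflectionE /=.
  rewrite !lfunE /= !subr0 => /eqP; rewrite -subr_eq0 -opprD oppr_eq0.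
  by rewrite -[1 + 1]/(2%:R) pnatr_eq0.
(* Without w_0, the vector part of a trivial action forces every [n r] to vanish, and u is the
   element a of Z. *)
rewrite uE mulg1 in u1; rewrite u1 in anB.
have [/matrixP d0 _] := acts_id sigma_basis anB.
rewrite uE mulg1 lattice_prod0 ?mulg1 // => r.
have /eqP := d0 r 0; rewrite summxE (bigD1 r) //= big1 => [|s sr].
  by rewrite /d -scaler_int !mxE !eqxx mulr1 addr0 intr_eq0 => /eqP.
by rewrite /d -scaler_int !mxE eq_sym (negPf sr) mulr0.
Qed.

Lemma Zcomb_inj : injective (Zcomb sigma).
Proof.
move=> c d; rewrite !Zcomb_lincomb => /(lincomb_inj sigma_basis)/matrixP cd.
by apply/ffunP => i; have := cd i 0; rewrite !mxE => /intr_inj.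
Qed.

Lemma ZcombD c d : Zcomb sigma (c + d) = Zcomb sigma c + Zcomb sigma d.
Proof.
by rewrite /Zcomb -big_split; apply: eq_bigr => i _; rewrite ffunE mulrzDr.
Qed.

Lemma ZcombN c : Zcomb sigma (- c) = - Zcomb sigma c.
Proof.
by apply/eqP; rewrite -addr_eq0 -ZcombD addNr /Zcomb big1 // => i _; rewrite ffunE.
Qed.

Lemma tau_Zcomb J : tau sigma J = Zcomb sigma [ffun i => (i \in J)%:Z].
Proof.
by rewrite /tau big_mkcond; apply: eq_bigr => i _; rewrite ffunE; case: (i \in J).
Qed.

(** * Homomorphisms to the group of order two *)

Section Detection.
Variable J0 : {set 'I_nu}.

Definition in_coset (x : V0) : bool :=
  `[< exists c, x = tau sigma J0 + Zcomb sigma c *+ 2 >].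

Lemma in_cosetD x c : in_coset (x + Zcomb sigma c *+ 2) = in_coset x.
Proof.
have H y d : in_coset y -> in_coset (y + Zcomb sigma d *+ 2).
  move=> /asboolP[e ->]; apply/asboolP; exists (e + d).
  by rewrite ZcombD mulrnDl [RHS]addrA.
apply/idP/idP => [/(H _ (- c))|]; last exact: H.
by rewrite ZcombN mulNrn addrK.
Qed.

(** The coordinates of tau_J are 0 or 1, so congruence modulo 2 means equality. *)
Lemma in_coset_tau J : in_coset (tau sigma J) = (J == J0).
Proof.
apply/asboolP/eqP => [[c]|->]; last first.
  exists 0; suff -> : Zcomb sigma 0 = 0 by rewrite mul0rn addr0.
  by rewrite /Zcomb big1 // => i _; rewrite ffunE.
rewrite !tau_Zcomb mulr2n -!ZcombD => /Zcomb_inj/ffunP E.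
by apply/setP => i; have := E i; rewrite !ffunE; do 2![case: (i \in _)] => //=; lia.
Qed.

Definition swap : {perm bool} := tperm true false.

Lemma swap_sqr : (swap * swap = 1)%g. Proof. exact: tperm2. Qed.

(** The group of order two is realized as the permutations of [bool]. *)
Definition detect_root (a : Rx S) : {perm bool} :=
  if in_coset (val a).1.2 then swap else 1%g.

(** Reflections preserve the class of the V0-component modulo 2 Lambda, which makes [detect_root]
    respect the conjugation relations. *)
Lemma reflection_Rx (a b : Rx S) :
  exists c, (reflection (val a) (val b)).1.2 = (val b).1.2 + Zcomb sigma c *+ 2.
Proof.
have H x : S x -> exists c, (reflection (alpha1 V0 + iso x) (val b)).1.2 =
    (val b).1.2 + Zcomb sigma c *+ 2.
  move=> Sx; have [c xE] := semilattice_Zcomb Sx; rewrite reflectionE /= {2}xE.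
  have := set_valP b; rewrite {1}RxE => -[] [y Sy <-] /=;
    rewrite ?oppr0 !addr0 lfunE /= ?addr0.
    by exists (- c); rewrite mulr1 scaler_nat ZcombN mulNrn.
  by exists c; rewrite mulrN1 scaleNr opprK scaler_nat.
have := set_valP a; rewrite {1}RxE => -[] [x Sx aE].
  by rewrite -[val a]aE; apply: H.
(* The root -alpha_1 + x has the same reflection as alpha_1 - x. *)
have -> : val a = - (alpha1 V0 + iso (- x)).
  by rewrite iso_opp opprK -[val a]aE.
have -> u : reflection (- (alpha1 V0 + iso (- x))) u =
            reflection (alpha1 V0 + iso (- x)) u.
  rewrite /reflection; congr (_ - _).
  rewrite -scaleN1r -[- 1 *: _]addr0 formDZr (Defs.formC u 0) Defs.form0l !addr0 scalerA.
  by rewrite mulrN1 mulNr mul1r opprK.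
exact/H/(S_N SB2).
Qed.

Lemma detect_rels v v' : what_rel v v' ->
  word_eval detect_root v = word_eval detect_root v'.
Proof.
case=> [a|a b c cE]; rewrite /word_eval !big_cons !big_nil /= !mulg1.
  by rewrite /detect_root; case: ifP => _; rewrite ?swap_sqr ?mulg1.
have [d bE] := reflection_Rx a b; rewrite /detect_root cE bE in_cosetD.
by do 2![case: ifP => _]; rewrite ?mulg1 ?mul1g ?mulgA ?swap_sqr ?mul1g.
Qed.

Definition detect (u : what S) : {perm bool} := pres_lift detect_root u.

Lemma detectM : {morph detect : u v / (u * v)%g}.
Proof. by move=> u v; apply: pres_liftM detect_rels u v. Qed.

Lemma detect1 : detect 1%g = 1%g.
Proof. by apply: (mulgI (detect 1%g)); rewrite -detectM !mulg1. Qed.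

HB.instance Definition _ :=
  isUMagmaMorphism.Build (what S) {perm bool} detect (detect1, detectM).

Lemma detect_w x : S x -> detect (hat_w S x) = if in_coset x then swap else 1%g.
Proof.
move=> Sx; have [a aE ->] := w_gen Sx.
by rewrite /detect (pres_lift_gen detect_rels) /detect_root aE /= add0r.
Qed.

Hypothesis J0_3 : (2 < #|J0|)%N.

(** Since J0 has at least three elements, neither 0 nor sigma_r lies in its coset. *)
Lemma detect_transl r : detect (t r) = 1%g.
Proof.
have E (J : {set 'I_nu}) : (#|J| <= 2)%N -> in_coset (tau sigma J) = false.
  move=> J2; rewrite in_coset_tau; apply/eqP => JE.
  by move: J2; rewrite JE leqNgt J0_3.
rewrite detectM !detect_w //.
have := E [set r]%SET; rewrite cards1 /tau big_set1 => -> //.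
by have := E finset.set0; rewrite cards0 /tau big_set0 => -> //; rewrite mulg1.
Qed.

(** Commutators and the t_r have value 1, so only the generator at tau_J can be detected. *)
Lemma detect_hat_z J : detect (z J) = if J \in supp then
  (if J == J0 then swap else 1%g) else 1%g.
Proof.
have w0 : detect (hat_w S 0) = 1%g.
  rewrite detect_w // -[0](_ : tau sigma finset.set0 = 0); last exact: big_set0.
  rewrite in_coset_tau; case: eqP => // J00.
  by move: J0_3; rewrite -J00 cards0.
have [Js|[r [s [rs -> Ns]]]|z1] := hat_z_cases J; last first.
(* The case z_J = 1 still allows J in the support; for J = J0 a second evaluation by [hat_z_supp]
   shows that both values agree. *)
- rewrite z1 detect1; case: ifP => // Js; case: eqP => // JE.
  have := detect1; rewrite -z1 hat_z_supp //.
  rewrite /zelt !detectM w0 mul1g gmulf_prod big1 => [|i _]; last exact: detect_transl.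
  by rewrite mulg1 (detect_w (tau_S Js)) JE in_coset_tau eqxx.
- by rewrite (negPf Ns) hat_z_pair // gmulfR /= !detect_transl commg1.
rewrite Js hat_z_supp // /zelt !detectM w0 mul1g gmulf_prod big1 => [|i _].
  by rewrite mulg1 (detect_w (tau_S Js)) in_coset_tau.
exact: detect_transl.
Qed.

(** The factors z_{r,s} are indexed by sets smaller than J0 and have value 1; in the remaining
    product only the factor at J0 counts. *)
Lemma detect_hat_u m eps (J : {J : {set 'I_nu} | J \in Esupp supp}) :
  val J = J0 -> detect (hat_u S sigma m eps) = (swap ^+ eps J)%g.
Proof.
move=> JE; rewrite hat_uE detectM /pairs_prod /eps_prod !gmulf_prod.
rewrite big1 => [|p lt_p]; last first.
  have zp : detect (z [set p.1; p.2]%SET) = 1%g.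
    rewrite detect_hat_z; case: ifP => // _; case: eqP => // E.
    by move: J0_3; rewrite -E cards2; case: (_ != _).
  by case: (m _ _) => k /=; rewrite ?gmulfV gmulfXn /= zp expg1n ?invg1.
rewrite mul1g (eq_bigr (fun K => if K == J then swap ^+ eps J else 1%g)%g).
  by rewrite -big_mkcond big_pred1_eq.
move=> K _; rewrite gmulfXn /= detect_hat_z.
have := valP K; rewrite inE => /andP[-> _].
case: (K =P J) => [->|KJ]; first by rewrite JE eqxx.
case: eqP => [KE|_]; last exact: expg1n.
by case: KJ; apply: val_inj; rewrite /= KE.
Qed.

End Detection.

(** * The bijection with integral collections and the equivalent conditions *)

Lemma hat_u_eps_inj m m' eps eps' :
  hat_u S sigma m eps = hat_u S sigma m' eps' -> eps = eps'.
Proof.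
move=> E; apply/ffunP => J; have := valP J; rewrite inE => /andP[_ J3].
have := congr1 (detect (val J)) E; rewrite !(detect_hat_u J3 _ _ (erefl (val J))).
have swap1 : swap != 1%g.
  by apply/eqP => /permP/(_ true); rewrite tpermL perm1.
case: (eps J) (eps' J) => [] [] //=; rewrite expg1 expg0 => /eqP.
  by rewrite (negPf swap1).
by rewrite eq_sym (negPf swap1).
Qed.

Lemma hat_u_ext m m' eps : (forall r s : 'I_nu, (r < s)%N -> m r s = m' r s) ->
  hat_u S sigma m eps = hat_u S sigma m' eps.
Proof.
move=> mm'; rewrite !hat_uE; congr (_ * _)%g.
by apply: eq_bigr => p /mm' ->.
Qed.

Lemma hat_u_ker_exps m eps : exps_of m eps <-> ker_psi S (hat_u S sigma m eps).
Proof. by rewrite hat_u_ker coef_exps. Qed.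

Lemma hat_u_bij :
  set_bij [set eps : collection supp | integral_collection eps] (ker_psi S)
          (fun eps => hat_u S sigma (exps eps) eps).
Proof.
split=> [eps Ieps|eps eps' _ _ /hat_u_eps_inj //|u uker].
  by apply/hat_u_ker_exps/exps_ofP.
have [m [eps uE]] := hat_Z_hat_u (ker_psi_hat_Z uker); rewrite uE in uker *.
have me : exps_of m eps by apply/hat_u_ker_exps.
have Ieps := exps_of_integral me.
(* Both m and [exps eps] satisfy [exps_of], which determines the exponents for r < s. *)
exists eps => //; apply: hat_u_ext => r s rs; apply: (@intr_inj rat).
by rewrite me // (exps_ofP Ieps).
Qed.

Lemma hat_Z_tfae u : hat_Z S sigma supp u ->
  [<-> ker_psi S u;
       (u ^+ 2 = 1)%g;
       exists2 n, (0 < n)%N & (u ^+ n = 1)%g;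
       exists m (eps : collection supp),
         [/\ integral_collection eps, exps_of m eps & u = hat_u S sigma m eps]].
Proof.
move=> Zu; tfae.
(* The square of u lies in P and in the kernel, and psi is injective on P. *)
- move=> uker; apply: pairs_ker; first exact: hat_Z_sqr.
  by apply/weyl_of_eq1; rewrite expg2 weyl_ofM; move/weyl_of_eq1: uker => ->; rewrite mulg1.
- by move=> u2; exists 2%N.
(* Finite order makes all coefficients of a normal form of u vanish. *)
- move=> [k k0 uk]; have [m [eps uE]] := hat_Z_hat_u Zu; exists m, eps.
  have me : exps_of m eps.
    by apply/coef_exps; apply: hat_u_torsion k0 _; rewrite -uE.
  by split=> //; apply: exps_of_integral me.
by move=> [m [eps [_ me ->]]]; apply/hat_u_ker_exps.
Qed.

End CentralElements.

Theorem proposition5p11 (R : realType) (V0 : vectType R) (nu : nat)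
    (S : set V0) (sigma : 'I_nu -> V0) (supp : {set {set 'I_nu}})
    (dimV0 : \dim {:V0} = nu)
    (semiS : semilattice S)
    (sigmaS : forall i, S (sigma i))
    (sigma_basis : Zbasis (Zspan S) sigma)
    (suppS : is_supp S sigma supp) :
  [/\ ker_psi S `<=` hat_Z S sigma supp,
      forall u : what S, hat_Z S sigma supp u ->
        [<-> ker_psi S u;
             (u ^+ 2 = 1)%g;
             exists2 n, (0 < n)%N & (u ^+ n = 1)%g;
             exists m (eps : collection supp),
               [/\ integral_collection eps, exps_of m eps
                 & u = hat_u S sigma m eps]]
    & set_bij [set eps : collection supp | integral_collection eps]
              (ker_psi S)
              (fun eps => hat_u S sigma (exps eps) eps)].
Proof.
split; first exact: ker_psi_hat_Z.
  by move=> u; apply: hat_Z_tfae.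
exact: hat_u_bij.
Qed.
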